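(* Let $\big((x_t^* )_{t=0}^{T},(u_t^* )_{t=0}^{T-1}\big)$ be an optimal state-action trajectory for the optimal control problem $$\min \sum_{t=0}^{T-1} c_t(x_t,u_t)\quad\text{subject to}\quad \begin{cases} x_{t+1}=f_t(x_t,u_t), & t=0,\dots,T-1,\\ x_t\in S_t, & t=0,\dots,T,\\ u_t\in U_t, & t=0,\dots,T-1,\\ \mathscr F(u_0,\dots,u_{T-1})=\sum_{t=0}^{T-1}F_tu_t=0, &\end{cases}$$ where the data are as described in the context. For each $t=0,\dots,T$ let $q^x_t(x_t^* )$ be a tent of $S_t$ at $x_t^*$, and for each $t=0,\dots,T-1$ let $q^u_t(u_t^* )$ be a local tent of $U_t$ at $u_t^*$. For $\theta\in\mathbb R$, $\gamma\in(\mathbb R^{\ell})^\star$, $\zeta\in(\mathbb R^{d})^\star$, $s\in\{0,\dots,T-1\}$, $\xi\in\mathbb R^d$, $\mu\in\mathbb R^m$ define the Hamiltonian $$H^{\theta,\gamma}(\zeta,s,\xi,\mu)=\langle \zeta,f_s(\xi,\mu)\rangle-\theta\,c_s(\xi,\mu)-\langle\gamma,F_s\mu\rangle\in\mathbb R .$$ Then there exist a trajectory $(\eta^f_t)_{t=0}^{T-1}\subset(\mathbb R^d)^\star$, a sequence $(\eta^x_t)_{t=0}^{T}\subset(\mathbb R^d)^\star$, and a pair $(\eta^C,\eta^u)\in\mathbb R\times(\mathbb R^\ell)^\star$ such that: (i) (non-negativity) $\eta^C\ge 0$; (ii) (non-triviality) $(\eta^f_t)_{t=0}^{T-1}$ and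 $(\eta^C,\eta^u)$ do not simultaneously vanish; (iii) (state and adjoint dynamics) $$x^*_{t+1}=\tfrac{\partial}{\partial\zeta}H^{\eta^C,\eta^u}(\eta^f_t,t,x^*_t,u^*_t)\ \text{ for } t=0,\dots,T-1,$$ $$\eta^f_{t-1}=\tfrac{\partial}{\partial\xi}H^{\eta^C,\eta^u}(\eta^f_t,t,x^*_t,u^*_t)-\eta^x_t\ \text{ for } t=1,\dots,T-1,$$ where $\eta^x_t$ lies in the dual cone of $q^x_t(x^*_t)$; (iv) (transversality) $$\tfrac{\partial}{\partial\xi}H^{\eta^C,\eta^u}(\eta^f_0,0,x^*_0,u^*_0)-\eta^x_0=0\quad\text{and}\quad \eta^f_{T-1}=-\eta^x_T,$$ where $\eta^x_0$ lies in the dual cone of $q^x_0(x^*_0)$ and $\eta^x_T$ lies in the dual cone of $q^x_T(x^*_T)$; (v) (Hamiltonian maximization, pointwise in time) for each $t=0,\dots,T-1$, $$\Big\langle \tfrac{\partial}{\partial\mu}H^{\eta^C,\eta^u}(\eta^f_t,t,x^*_t,u^*_t),\tilde u_t\Big\rangle\le 0\quad\text{whenever } u^*_t+\tilde u_t\in q^u_t(u^*_t);$$ (vi) (frequency constraints) $\mathscr F(u^*_0,\dots,u^*_{T-1})=0$.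
   Context: Data: $T,d,m$ are positive integers; for $t=0,\dots,T-1$ the maps $f_t:\mathbb R^d\times\mathbb R^m\to\mathbb R^d$ and $c_t:\mathbb R^d\times\mathbb R^m\to\mathbb R$ are continuously differentiable; $S_t\subset\mathbb R^d$ ($t=0,\dots,T$) and $U_t\subset\mathbb R^m$ ($t=0,\dots,T-1$) are non-empty sets. The minimization is over all state and control sequences satisfying the constraints (in particular $x_0$ ranges over $S_0$). An optimal state-action trajectory is a feasible pair attaining the minimum. $V^\star$ is the dual space of $V$; $(\mathbb R^n)^\star$ is identified with $\mathbb R^n$ via the standard inner product $\langle\cdot,\cdot\rangle$, and partial derivatives are regarded as gradients. Frequency constraint map: for $u=(u_0,\dots,u_{T-1})\in(\mathbb R^m)^T$ let $u^{(k)}\in\mathbb R^T$ ($k=1,\dots,m$) be the sequence of $k$-th components. Let $\Phi\in\mathbb C^{T\times T}$ be the DFT matrix with entries $\Phi_{\xi t}=T^{-1/2}e^{-2\pi i\xi t/T}$, $\xi,t=0,\dots,T-1$, and $\bar\Phi=\mathrm{blkdiag}(\Phi,\dots,\Phi)\in\mathbb C^{mT\times mT}$. For each $k$ a set $W^{(k)}\subset\{0,\dots,T-1\}$ of allowed frequencies is given; $D^{(k)}$ is the matrix formed by the rows $e_\xi$ of the identity $I_T$ with $\xi\notin W^{(k)}$, and $D=\mathrm{blkdiag}(D^{(1)},\dots,D^{(m)})$. Let $L\in\mathbb R^{mT\times mT}$ be the permutation matrix mapping the stacked vector $(u^{(1)},\dots,u^{(m)})$ to $(u_0,\dots,u_{T-1})$.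 Form $\begin{pmatrix}D\,\mathrm{Re}\,\bar\Phi\\ D\,\mathrm{Im}\,\bar\Phi\end{pmatrix}L^{-1}$, eliminate its zero rows if necessary, let $\ell$ be the resulting number of rows, and partition its columns as $[F_0\ F_1\ \cdots\ F_{T-1}]$ with $F_t\in\mathbb R^{\ell\times m}$. Then $\mathscr F(u_0,\dots,u_{T-1})=\sum_{t=0}^{T-1}F_tu_t$; the constraint $\mathscr F=0$ says that the DFT of $u^{(k)}$ is supported in $W^{(k)}$ for every $k$. Tents: a set $K\subset\mathbb R^n$ is a cone with vertex $v$ if $K=v+K'$ with $K'$ a non-empty set closed under multiplication by every $\alpha\ge0$. Let $\Omega\subset\mathbb R^n$ and $v\in\Omega$. A convex cone $Q$ with vertex $v$ is a tent of $\Omega$ at $v$ if there is a smooth map $\psi$ defined in a neighbourhood of $v$ such that $\psi(z)=z+o(z-v)$ and, for some $\epsilon>0$, $\psi(z)\in\Omega$ for all $z\in Q\cap B_\epsilon(v)$. A convex cone $K$ with vertex $v$ is a local tent of $\Omega$ at $v$ if for every $z$ in the relative interior of $K$ there is a convex cone $Q\subset K$ with vertex $v$ which is a tent of $\Omega$ at $v$, with $z$ in the relative interior of $Q$ and $\mathrm{aff}\,Q=\mathrm{aff}\,K$. The dual cone of a convex cone $K$ with vertex $v$ is $\{y\in(\mathbb R^n)^\star:\langle y,z-v\rangle\le0\ \text{for all } z\in K\}$. *)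

(* Defs.v *)
From HB Require Import structures.
From mathcomp Require Import all_boot all_order all_algebra.
From mathcomp Require Import complex.
From mathcomp Require Import all_classical all_reals all_analysis.

Set Implicit Arguments.
Unset Strict Implicit.
Unset Printing Implicit Defensive.

Import Order.TTheory GRing.Theory Num.Theory.
Import numFieldNormedType.Exports.

Local Open Scope classical_set_scope.
Local Open Scope ring_scope.

(* R^n is 'cV[R]_n, and (R^n)^* is identified with it through [dot]. The library
   norm on 'cV[R]_n is the sup norm; the notions below (differentiability,
   little-o, existence of a small ball) do not depend on the choice of norm. *)
Definition dot (R : realType) n (y z : 'cV[R]_n) : R :=
  \sum_(i < n) y i 0 * z i 0.

Definition grad (R : realType) n (g : 'cV[R]_n -> R^o) (x : 'cV[R]_n)
  : 'cV[R]_n := \col_i 'D_(delta_mx i 0) g x.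

(* Pointwise continuity of z |-> 'd g z is, in finite dimension, the same as its
   continuity for the operator norm. [C1_on] is only used with A open. *)
Definition C1_on (R : realType) (V W : normedModType R) (A : set V)
    (g : V -> W) : Prop :=
  forall z, A z ->
    differentiable g z /\ forall v : V, {for z, continuous (fun y => 'd g y v)}.

Definition continuously_differentiable (R : realType) (V W : normedModType R)
    (g : V -> W) : Prop := C1_on [set: V] g.

Section Tents.
Variables (R : realType) (n : nat).
Implicit Types (v y z : 'cV[R]_n) (A K Q Omega : set 'cV[R]_n).

Definition cone_at v K : Prop :=
  exists K' : set 'cV[R]_n,
    [/\ K' !=set0,
        forall (a : R) y, 0 <= a -> K' y -> K' (a *: y)
      & K = [set v + y | y in K']].

Definition convex_cone_at v K : Prop := cone_at v K /\ convex_set K.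

Definition affine_set A : Prop :=
  forall y z (a : R), A y -> A z -> A (a *: y + (1 - a) *: z).

Definition aff A : set 'cV[R]_n := smallest affine_set A.

Definition relint A : set 'cV[R]_n :=
  [set z | A z /\ exists2 e : R, 0 < e & ball z e `&` aff A `<=` A].

(* The map psi is total here; only its values near v matter, since e and the
   open set N may be shrunk. Smooth means continuously differentiable. *)
Definition tent Omega v Q : Prop :=
  [/\ Omega v, convex_cone_at v Q
    & exists psi : 'cV[R]_n -> 'cV[R]_n,
      [/\ exists N : set 'cV[R]_n, [/\ open N, N v & C1_on N psi],
          forall z, psi z = z +o_(z \near v) (z - v)
        & exists2 e : R, 0 < e &
            forall z, Q z -> ball v e z -> Omega (psi z)]].

Definition local_tent Omega v K : Prop :=
  [/\ Omega v, convex_cone_at v K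
    & forall z, relint K z ->
      exists Q : set 'cV[R]_n,
        [/\ Q `<=` K, tent Omega v Q, relint Q z & aff Q = aff K]].

Definition dual_cone v K : set 'cV[R]_n :=
  [set y | forall z, K z -> dot y (z - v) <= 0].

End Tents.

Section FrequencyConstraints.
Variables (R : realType) (T m : nat).

Definition expi (a : R) : R[i] := (cos a +i* sin a)%C.

Definition dft_mx : 'M[R[i]]_T :=
  \matrix_(xi < T, t < T)
    (((Num.sqrt T%:R)^-1)%:C%C *
     expi (- (2 * pi * xi%:R * t%:R / T%:R))).

Definition dft_bar : 'M[R[i]]_(\sum_(k < m) T) := \mxdiag_(k < m) dft_mx.

Variable W : 'I_m -> {set 'I_T}.

Definition forbidden_rows (k : 'I_m) : 'M[R]_(#|~: W k|, T) :=
  rowsub (@enum_val _ (mem (~: W k))) 1%:M.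

Definition forbidden_mx
  : 'M[R]_(\sum_(k < m) #|~: W k|, \sum_(k < m) T) :=
  \mxblock_(k < m, l < m) (if k == l then forbidden_rows k else 0).

Lemma stack_dim : (\sum_(k < m) T = \sum_(t < T) m)%N.
Proof. by rewrite !sum_nat_const !card_ord mulnC. Qed.

(* Rows are indexed by pairs (t, k), the stacking (u_0, .., u_(T-1)); columns by
   pairs (k, t), the stacking (u^(1), .., u^(m)). Both dimensions are m * T, but
   only propositionally equal to each other. *)
Definition stack_perm : 'M[R]_(\sum_(t < T) m) :=
  castmx (erefl, stack_dim)
    (\matrix_(i < \sum_(t < T) m, j < \sum_(k < m) T)
      ((tagnat.sig1 i == tagnat.sig2 j) && (tagnat.sig2 i == tagnat.sig1 j))%:R).

Definition freq_mx :=
  castmx (erefl, stack_dim)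
    (col_mx (forbidden_mx *m map_mx (@complex.Re R) dft_bar)
            (forbidden_mx *m map_mx (@complex.Im R) dft_bar))
  *m invmx stack_perm.

Definition nonzero_rows p q (A : 'M[R]_(p, q)) : {set 'I_p} :=
  [set i | row i A != 0].

Definition drop_zero_rows p q (A : 'M[R]_(p, q))
  : 'M[R]_(#|nonzero_rows A|, q) :=
  rowsub (@enum_val _ (mem (nonzero_rows A))) A.

Definition freq_dim : nat := #|nonzero_rows freq_mx|.

Definition freq_block (t : 'I_T) : 'M[R]_(freq_dim, m) :=
  submxrow (drop_zero_rows freq_mx) t.

Definition freq_map (u : 'I_T -> 'cV[R]_m) : 'cV[R]_freq_dim :=
  \sum_(t < T) freq_block t *m u t.

End FrequencyConstraints.

Section OptimalControl.
Variables (R : realType) (T d m : nat).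
Variables (f : 'I_T -> 'cV[R]_d * 'cV[R]_m -> 'cV[R]_d)
          (c : 'I_T -> 'cV[R]_d * 'cV[R]_m -> R^o)
          (S : 'I_T.+1 -> set 'cV[R]_d) (U : 'I_T -> set 'cV[R]_m)
          (W : 'I_m -> {set 'I_T}).

(* For t in {0, .., T-1}: the instants t and t+1 of {0, .., T}. *)
Definition at_time (t : 'I_T) : 'I_T.+1 := widen_ord (leqnSn T) t.
Definition at_succ (t : 'I_T) : 'I_T.+1 := lift ord0 t.

Definition total_cost (x : 'I_T.+1 -> 'cV[R]_d) (u : 'I_T -> 'cV[R]_m) : R :=
  \sum_(t < T) c t (x (at_time t), u t).

Definition feasible (x : 'I_T.+1 -> 'cV[R]_d) (u : 'I_T -> 'cV[R]_m) : Prop :=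
  [/\ forall t : 'I_T, x (at_succ t) = f t (x (at_time t), u t),
      forall t : 'I_T.+1, S t (x t),
      forall t : 'I_T, U t (u t)
    & freq_map W u = 0].

Definition optimal (x : 'I_T.+1 -> 'cV[R]_d) (u : 'I_T -> 'cV[R]_m) : Prop :=
  feasible x u /\
  forall x' u', feasible x' u' -> total_cost x u <= total_cost x' u'.

Definition hamiltonian (theta : R) (gamma : 'cV[R]_(freq_dim R W))
    (zeta : 'cV[R]_d) (s : 'I_T) (xi : 'cV[R]_d) (mu : 'cV[R]_m) : R^o :=
  dot zeta (f s (xi, mu)) - theta * c s (xi, mu)
  - dot gamma (freq_block R W s *m mu).

End OptimalControl.

Arguments hamiltonian {R T d m} f c W theta gamma zeta s xi mu.

(* Main.v *)
Require Import Defs.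
From HB Require Import structures.
From mathcomp Require Import all_boot all_order all_algebra finmap.
From mathcomp Require Import ring lra.
From mathcomp Require Import all_classical all_reals all_analysis.

Set Implicit Arguments.
Unset Strict Implicit.
Unset Printing Implicit Defensive.

Import Order.TTheory GRing.Theory Num.Theory.
Import numFieldNormedType.Exports.

Local Open Scope classical_set_scope.
Local Open Scope ring_scope.

(** The maximum principle is a separation theorem. Linearize the constraints
    along the optimal trajectory: a variation is a state variation in the tents
    qx, a control variation in the local tents qu, and a slack on the cost, and
    it is mapped to the first order change of the dynamics, of the frequency
    constraint and of the cost. The variations form a convex cone. Either a
    nonzero vector y pairs nonpositively with the whole image of this cone
    (separator_exists), or the image is the whole space.

    In the first case the components of y, up to sign, are the multipliers.
    Regrouping the pairing by variables (separator_lagrangian) makes the gradients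
    of the Hamiltonian appear, and testing the inequality on variations of a
    single state, a single control, or the slack alone gives the dual cone
    conditions, the pointwise maximization and the sign of the cost multiplier.
    The adjoint equation then defines the vectors of the dual cones
    (adjoint_defect).

    The second case contradicts optimality (spanning_contradicts_optimality).
    By compactness of the sphere, finitely many variations positively span the
    image space, and some strictly positive combination z of variations has image
    0 (positive_spanning_with_zero). Since z is in the relative interior of each
    local tent, it singles out an ordinary tent Q t of each control set, and
    tilting the finite family towards z moves it into these tents
    (relint_absorbs) without changing its image. The tent maps now turn small
    nonnegative combinations of the family into points of the constraint sets,
    and the constraints become functions of the coefficients that are strictly
    differentiable at 0. An exact penalty argument (local_surjectivity) solves
    for zero change in the equality constraints and a decrease of the cost, which
    produces a better feasible trajectory. The same argument, applied to the linearized
    constraints themselves, provides z. *)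

(** * Strict differentiability *)

Section StrictDifferentiability.
Variable R : realType.
Implicit Types U V W : normedModType R.

Lemma linear_morphB V W (L : V -> W) : linear L -> {morph L : y z / y - z}.
Proof.
by move=> LL y z; rewrite -scaleN1r addrC LL scaleN1r addrC.
Qed.

(** Strict differentiability: the linearization controls the increments of h
    between any two points close to a, not only those that start at a. Descent
    steps taken at points near a are then compared with the single map L. *)
Definition strict_diff V W (h L : V -> W) (a : V) : Prop :=
  [/\ linear L,
      exists2 C : R, 0 < C & forall v, `|L v| <= C * `|v|
    & forall e : R, 0 < e -> exists2 r : R, 0 < r & forall y z,
        `|y - a| < r -> `|z - a| < r ->
        `|h y - h z - L (y - z)| <= e * `|y - z|].

Lemma strict_diff_lipschitz V W (h L : V -> W) a : strict_diff h L a ->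
  exists2 C : R, 0 < C & exists2 r : R, 0 < r & forall y z,
    `|y - a| < r -> `|z - a| < r -> `|h y - h z| <= C * `|y - z|.
Proof.
move=> [_ [C C0 LC] /(_ 1 ltr01)[r r0 hr]].
exists (1 + C); first by rewrite addr_gt0.
exists r => // y z ya za; rewrite -(subrK (L (y - z)) (h y - h z)) mulrDl.
by rewrite (le_trans (ler_normD _ _))// lerD ?hr.
Qed.

(** Increments near a are Lipschitz, so continuity holds on a whole ball. *)
Lemma strict_diff_near_continuous V W (h L : V -> W) a :
  strict_diff h L a -> exists2 r : R, 0 < r & forall v, `|v - a| < r ->
    {for v, continuous h}.
Proof.
move=> /strict_diff_lipschitz[C C0 [r r0 hC]]; exists r => // v va.
apply/cvgrPdist_lt => e e0.
have : \forall z \near v, `|z - a| < r.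
  have : open_nbhs v (ball a r).
    by split; [exact: ball_open|rewrite -ball_normE/= distrC].
  by move=> /open_nbhs_nbhs; apply: filterS => z; rewrite -ball_normE/= distrC.
have : \forall z \near v, `|v - z| < e / C.
  have : (id z @[z --> v] --> v) by exact: cvg_id.
  by move=> /cvgrPdist_lt; apply; exact: divr_gt0.
apply: filterS2 => z vz za.
by rewrite (le_lt_trans (hC _ _ va za))// mulrC -ltr_pdivlMr.
Qed.

Lemma strict_diff_comp U V W (h L : U -> V) (g M : V -> W) (a : U) :
  strict_diff h L a -> strict_diff g M (h a) -> strict_diff (g \o h) (M \o L) a.
Proof.
move=> sh sg; have [C C0 [rC rC0 hC]] := strict_diff_lipschitz sh.
case: sh => LL [CL CL0 LC] he; case: sg => ML [CM CM0 MC] ge; split.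
- by move=> k y z /=; rewrite LL ML.
- exists (CM * CL); first exact: mulr_gt0.
  by move=> v /=; rewrite (le_trans (MC _))// -mulrA ler_wpM2l// ltW.
move=> e e0.
have e1 : 0 < e / 2 / C by rewrite !divr_gt0.
have e2 : 0 < e / 2 / CM by rewrite !divr_gt0.
have [r1 r10 gr] := ge _ e1; have [r2 r20 hr] := he _ e2.
exists (Num.min (Num.min rC r2) (r1 / C)).
  by rewrite !lt_min rC0 r20 divr_gt0.
move=> y z; rewrite !lt_min => /andP[/andP[yC y2] y1] /andP[/andP[zC z2] z1].
have a0 : `|a - a| < rC by rewrite subrr normr0.
have hy : `|h y - h a| < r1.
  by rewrite (le_lt_trans (hC _ _ yC a0))// mulrC -ltr_pdivlMr.
have hz : `|h z - h a| < r1.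
  by rewrite (le_lt_trans (hC _ _ zC a0))// mulrC -ltr_pdivlMr.
rewrite /= -(subrK (M (h y - h z)) (g (h y) - g (h z))) -addrA -(linear_morphB ML).
rewrite (le_trans (ler_normD _ _))// (splitr e) mulrDl lerD//.
  rewrite (le_trans (gr _ _ hy hz))// mulrAC ler_pdivrMr// -[leRHS]mulrA.
  by rewrite ler_pM2l ?divr_gt0// [leRHS]mulrC hC.
by rewrite (le_trans (MC _))// mulrC -ler_pdivlMr// mulrAC hr.
Qed.

Lemma strict_diff_eq V W (h h' L L' : V -> W) a :
  h =1 h' -> L =1 L' -> strict_diff h L a -> strict_diff h' L' a.
Proof. by move=> /funext<- /funext<-. Qed.

Lemma strict_diff_affine V W (b : W) (L : V -> W) a : linear L ->
  (exists2 C : R, 0 < C & forall v, `|L v| <= C * `|v|) ->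
  strict_diff (fun v => b + L v) L a.
Proof.
move=> LL LC; split=> // e e0; exists 1 => // y z _ _.
by rewrite opprD addrACA subrr add0r (linear_morphB LL) subrr normr0 mulr_ge0// ltW.
Qed.

Lemma strict_diff_cst V W (b : W) (a : V) : strict_diff (fun=> b) (fun=> 0) a.
Proof.
split=> [k y z||e e0]; first by rewrite scaler0 addr0.
- by exists 1 => // v; rewrite normr0 mul1r.
- by exists 1 => // y z _ _; rewrite !subrr normr0 mulr_ge0// ltW.
Qed.

Lemma strict_diffB V W (h h' L L' : V -> W) a : strict_diff h L a ->
  strict_diff h' L' a ->
  strict_diff (fun v => h v - h' v) (fun v => L v - L' v) a.
Proof.
move=> [LL [C C0 LC] hd] [LL' [C' C0' LC'] hd']; split.
- by move=> k y z; rewrite LL LL' scalerBr opprD addrACA.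
- exists (C + C'); first exact: addr_gt0.
  by move=> v; rewrite mulrDl (le_trans (ler_normB _ _))// lerD.
move=> e e0; have e20 : 0 < e / 2 by rewrite divr_gt0.
have [r r0 hr] := hd _ e20; have [r' r0' hr'] := hd' _ e20.
exists (Num.min r r'); first by rewrite lt_min r0.
move=> y z; rewrite !lt_min => /andP[y1 y2] /andP[z1 z2].
rewrite (splitr e) mulrDl.
have AC (p q s t : W) : (p - q) - (s - t) = (p - s) - (q - t).
  by rewrite !opprB addrACA [RHS]addrACA [- q - s]addrC.
rewrite (AC (h y)) (AC (h y - h z)).
by rewrite (le_trans (ler_normB _ _))// lerD ?hr ?hr'.
Qed.

Lemma strict_diffD V W (h h' L L' : V -> W) a : strict_diff h L a ->
  strict_diff h' L' a ->
  strict_diff (fun v => h v + h' v) (fun v => L v + L' v) a.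
Proof.
move=> hd hd'; apply: strict_diff_eq
    (strict_diffB hd (strict_diffB (strict_diff_cst 0 a) hd')) => v /=.
- by rewrite sub0r opprK.
- by rewrite sub0r opprK.
Qed.

Lemma strict_diff_sum V W I (s : seq I) (h L : I -> V -> W) a :
  (forall i, strict_diff (h i) (L i) a) ->
  strict_diff (fun v => \sum_(i <- s) h i v) (fun v => \sum_(i <- s) L i v) a.
Proof.
move=> hd; elim: s => [|i s ih].
  by apply: strict_diff_eq (strict_diff_cst 0 a) => v; rewrite big_nil.
by apply: strict_diff_eq (strict_diffD (hd i) ih) => v; rewrite big_cons.
Qed.

Lemma strict_diff_pair U V W (h L : U -> V) (h' L' : U -> W) a :
  strict_diff h L a -> strict_diff h' L' a ->
  strict_diff (fun v => (h v, h' v)) (fun v => (L v, L' v)) a.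
Proof.
move=> [LL [C C0 LC] hd] [LL' [C' C0' LC'] hd']; split.
- by move=> k y z; rewrite LL LL'.
- exists (Num.max C C'); first by rewrite lt_max C0.
  move=> v; rewrite prod_normE/= ge_max.
  by rewrite (le_trans (LC v)) ?ler_wpM2r// ?(le_trans (LC' v)) ?ler_wpM2r//
    le_max lexx ?orbT.
move=> e e0; have [r r0 hr] := hd _ e0; have [r' r0' hr'] := hd' _ e0.
exists (Num.min r r'); first by rewrite lt_min r0.
move=> y z; rewrite !lt_min => /andP[y1 y2] /andP[z1 z2].
by rewrite prod_normE/= ge_max hr ?hr'.
Qed.

Lemma mx_norm_le m n (A : 'M[R]_(m, n)) (e : R) :
  0 <= e -> (forall i j, `|A i j| <= e) -> `|A| <= e.
Proof.
move=> e0 Ae; rewrite [leLHS]/Num.norm/= mx_normrE.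
by apply/bigmax_leP; split=> // -[i j] _ /=.
Qed.

Lemma mx_coord_le m n (A : 'M[R]_(m, n)) i j : `|A i j| <= `|A|.
Proof.
rewrite [leRHS]/Num.norm/= mx_normrE.
by apply/bigmax_geP; right => /=; exists (i, j).
Qed.

Lemma strict_diff_coord V m n (h L : V -> 'M[R]_(m, n)) a i j :
  strict_diff h L a ->
  strict_diff (fun v => h v i j : R^o) (fun v => L v i j : R^o) a.
Proof.
have sd : strict_diff (fun A : 'M[R]_(m, n) => A i j : R^o)
    (fun A : 'M[R]_(m, n) => A i j : R^o) (h a).
  pose cij (A : 'M[R]_(m, n)) : R^o := A i j.
  have cL : linear cij by move=> k y z; rewrite /cij !mxE.
  have cC : exists2 C : R, 0 < C & forall A, `|cij A| <= C * `|A|.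
    by exists 1 => // A; rewrite mul1r; exact: mx_coord_le.
  apply: strict_diff_eq (strict_diff_affine 0 (h a) cL cC) => //.
  by move=> A; exact: add0r.
by move=> hL; exact: strict_diff_comp hL sd.
Qed.

Lemma strict_diff_mx V m n (h L : V -> 'M[R]_(m, n)) a :
  (forall i j, strict_diff (fun v => h v i j : R^o) (fun v => L v i j : R^o) a) ->
  strict_diff h L a.
Proof.
move=> hij; split.
- move=> k y z; apply/matrixP => i j; rewrite !mxE.
  by have [+ _ _] := hij i j => ->.
- have /choice[C CP] : forall p : 'I_m * 'I_n, exists C : R,
      0 < C /\ forall v, `|L v p.1 p.2| <= C * `|v|.
    by move=> [i j]; have [_ [C C0 CP] _] := hij i j; exists C.
  exists (1 + \sum_p C p).
    by rewrite ltr_pwDl// sumr_ge0// => p _; rewrite ltW//; have [] := CP p.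
  move=> v; apply: mx_norm_le => [|i j].
    rewrite mulr_ge0// addr_ge0// sumr_ge0// => p _.
    by rewrite ltW//; have [] := CP p.
  have [_ /(_ v)/le_trans] := CP (i, j); apply; rewrite ler_wpM2r//.
  rewrite (bigD1 (i, j))//= addrCA lerDl addr_ge0// sumr_ge0// => p _.
  by rewrite ltW//; have [] := CP p.
move=> e e0; have /choice[r rP] : forall p : 'I_m * 'I_n, exists r : R,
    0 < r /\ forall y z, `|y - a| < r -> `|z - a| < r ->
    `|h y p.1 p.2 - h z p.1 p.2 - L (y - z) p.1 p.2| <= e * `|y - z|.
  by move=> [i j]; have [_ _ /(_ e e0)[r r0 rP]] := hij i j; exists r.
exists (\big[Num.min/1]_p r p).
  by apply/bigmin_gtP; split=> // p _; have [] := rP p.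
move=> y z /bigmin_gtP[_ ya] /bigmin_gtP[_ za]; apply: mx_norm_le => [|i j].
  by rewrite mulr_ge0// ltW.
rewrite !mxE; have [_] := rP (i, j); apply; [exact: ya|exact: za].
Qed.

(** Finite dimension, expressed by a finite family of coordinates bounded by the
    norm: a form that is stable under products. *)
Definition finite_coords V : Prop :=
  exists (I : finType) (b : I -> V) (phi : I -> V -> R), exists2 C : R, 0 < C &
    forall v, v = \sum_i phi i v *: b i /\ forall i, `|phi i v| <= C * `|v|.

Lemma finite_coords_mx m n : finite_coords 'M[R]_(m, n).
Proof.
exists ('I_m * 'I_n)%type, (fun p => delta_mx p.1 p.2), (fun p (A : 'M[R]_(m, n)) => A p.1 p.2).
exists 1 => // A; split=> [|p]; last by rewrite mul1r mx_coord_le.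
by rewrite [LHS]matrix_sum_delta pair_bigA.
Qed.

Lemma finite_coords_prod V W :
  finite_coords V -> finite_coords W -> finite_coords (V * W)%type.
Proof.
move=> [I [b [phi [C C0 Cb]]]] [I' [b' [phi' [C' C'0 C'b]]]].
exists (I + I')%type,
  (fun k => match k with inl i => (b i, 0) | inr i => (0, b' i) end),
  (fun k v => match k with inl i => phi i v.1 | inr i => phi' i v.2 end).
have CC : 0 < Num.max C C' by rewrite lt_max C0.
exists (Num.max C C') => // -[v w]; split.
  rewrite big_sumType/=; have [vE _] := Cb v; have [wE _] := C'b w.
  have -> : \sum_i phi i v *: (b i, 0 : W) = (v, 0).
    rewrite [in RHS]vE; elim/big_ind2 : _ => // [? ? ? ? -> ->|i _].
      by congr (_, _) => /=; rewrite addr0.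
    by congr (_, _); rewrite /= scaler0.
  have -> : \sum_i phi' i w *: (0 : V, b' i) = (0, w).
    rewrite [in RHS]wE; elim/big_ind2 : _ => // [? ? ? ? -> ->|i _].
      by congr (_, _) => /=; rewrite addr0.
    by congr (_, _); rewrite /= scaler0.
  by congr (_, _); rewrite /= ?addr0 ?add0r.
rewrite prod_normE/= => -[i|i].
  have [_ /(_ i)/le_trans] := Cb v; apply; apply: ler_pM => //; first exact: ltW.
    by rewrite le_max lexx.
  by rewrite le_max lexx.
have [_ /(_ i)/le_trans] := C'b w; apply; apply: ler_pM => //; first exact: ltW.
  by rewrite le_max lexx orbT.
by rewrite le_max lexx orbT.
Qed.

Lemma finite_coords_linear_bounded V W (L : V -> W) : linear L ->
  finite_coords V -> exists2 C : R, 0 < C & forall v, `|L v| <= C * `|v|.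
Proof.
move=> LL [I [b [phi [C C0 Cb]]]]; exists (1 + \sum_i C * `|L (b i)|).
  by rewrite ltr_pwDl// sumr_ge0// => i _; rewrite mulr_ge0// ltW.
pose lL := GRing.isLinear.Build _ _ _ _ L LL.
pose L' : {linear V -> W} := HB.pack L lL.
move=> v; have [vE phiC] := Cb v.
rewrite [in leLHS]vE -[L]/(L' : V -> W) linear_sum.
rewrite (le_trans (ler_norm_sum _ _ _))// mulrDl ler_wpDl ?mul1r//.
rewrite mulr_suml ler_sum// => i _; rewrite linearZ normrZ mulrAC.
by rewrite ler_wpM2r// phiC.
Qed.

Lemma strict_diff_linear V W (L : V -> W) a :
  finite_coords V -> linear L -> strict_diff L L a.
Proof.
move=> fV LL; apply: strict_diff_eq
  (strict_diff_affine 0 a LL (finite_coords_linear_bounded LL fV)) => // v.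
exact: add0r.
Qed.

Lemma mean_value V (g : V -> R^o) (y z : V) :
  (forall s : R, 0 <= s <= 1 -> differentiable g (z + s *: (y - z))) ->
  exists2 s : R, 0 <= s <= 1 & g y - g z = 'd g (z + s *: (y - z)) (y - z).
Proof.
move=> dg; pose w := y - z; pose l (s : R) : V := z + s *: w.
have dl (s : R) : is_diff s l ( *:%R^~ w).
  rewrite (_ : l = cst z + ( *:%R^~ w)) //.
  by apply: is_diff_eq; rewrite add0r.
have dgl (s : R) : 0 <= s <= 1 ->
    is_derive s 1 (g \o l : R -> R) ('d g (l s) w).
  move=> s01; have dgs := dg _ s01.
  have ddl : differentiable l s by [].
  have dc := differentiable_comp ddl (dgs : differentiable g (l s)).
  apply: DeriveDef; first exact: diff_derivable.
  by rewrite deriveE// diff_comp//= diff_val scale1r.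
have [s||s s01 sE] := @MVT_segment _ (g \o l) (fun s => 'd g (l s) w) 0 1 ler01.
- by rewrite in_itv/= => /andP[s0 s1]; apply: dgl; rewrite !ltW.
- apply: derivable_within_continuous => t; rewrite in_itv/= => t01.
  by have [] := dgl _ t01.
exists s; first by rewrite in_itv/= in s01.
move: sE; rewrite subr0 mulr1 /l /= scale1r scale0r addr0 /w.
by rewrite [z + (y - z)]addrC subrK.
Qed.

(** By the mean value theorem the increment of g between z and y is the
    differential of g at a point of the segment, applied to y - z. Continuity of
    the differential on finitely many basis vectors makes it uniformly close to
    the differential at a. *)
Lemma C1_strict_diff_scalar V (g : V -> R^o) (N : set V) a :
  finite_coords V -> open N -> N a -> C1_on N g -> strict_diff g ('d g a) a.
Proof.
move=> fV oN Na gC1; split.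
- by move=> k y z; rewrite linearP.
- by apply: finite_coords_linear_bounded => // k y z; rewrite linearP.
move=> e e0; have [I [b [phi [C C0 Cb]]]] := fV.
pose k := e / (C * #|I|.+1%:R).
have k0 : 0 < k by rewrite divr_gt0// mulr_gt0.
have : \forall y \near a, N y /\
    forall i, `|'d g y (b i) - 'd g a (b i)| < k.
  apply: filterI; first exact: open_nbhs_nbhs.
  apply: filter_forall => i; have [_ /(_ (b i))] := gC1 _ Na.
  move=> /cvgrPdist_lt/(_ _ k0); apply: filterS => y.
  by rewrite distrC.
move=> /nbhs_ballP[r /= r0 ar]; exists r => // y z ya za.
have seg (s : R) : 0 <= s <= 1 -> ball a r (z + s *: (y - z)).
  move=> /andP[s0 s1]; rewrite -ball_normE /= distrC.
  have -> : z + s *: (y - z) - a = (1 - s) *: (z - a) + s *: (y - a).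
    have -> : y - z = (y - a) - (z - a) by rewrite opprB addrA subrK.
    by rewrite scalerBr scalerBl scale1r addrAC -[RHS]addrA [- _ + _ in RHS]addrC.
  rewrite (le_lt_trans (ler_normD _ _))// !normrZ.
  rewrite !ger0_norm ?subr_ge0//.
  have /orP[s00|s00] : (s == 0) || (0 < s) by rewrite -le0r.
    by rewrite (eqP s00) mul0r addr0 subr0 mul1r.
  have : s * `|y - a| < s * r by rewrite ltr_pM2l.
  have : (1 - s) * `|z - a| <= (1 - s) * r by rewrite ler_wpM2l ?subr_ge0// ltW.
  by lra.
have [s s01 ->] : exists2 s : R, 0 <= s <= 1 &
    g y - g z = 'd g (z + s *: (y - z)) (y - z).
  by apply: mean_value => s s01; have [/gC1[]] := ar _ (seg _ s01).
have [_ dk] := ar _ (seg _ s01); set p := z + _ in dk *.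
have [vE phiC] := Cb (y - z).
have dE q : 'd g q (y - z) = \sum_i phi i (y - z) * 'd g q (b i).
  by rewrite {1}vE linear_sum; apply: eq_bigr => i _; rewrite linearZ.
rewrite !dE -sumrB (le_trans (ler_norm_sum _ _ _))//.
have /le_trans : \sum_i `|phi i (y - z) * 'd g p (b i) -
    phi i (y - z) * 'd g a (b i)| <= \sum_(i in I) C * `|y - z| * k.
  by apply: ler_sum => i _; rewrite -mulrBr normrM; apply: ler_pM => //; rewrite ltW.
apply; rewrite sumr_const -[leLHS]mulr_natr.
(* k makes the #|I| coordinate errors add up to at most e * `|y - z| *)
have -> : C * `|y - z| * k * #|I|%:R = e * `|y - z| * (#|I|%:R / #|I|.+1%:R).
  by rewrite /k; field; rewrite (lt0r_neq0 C0) /= ?andbT; apply/eqP => h; move: (ler0n R #|I|); lra.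
apply: ler_piMr; first by rewrite mulr_ge0// ltW.
by rewrite ler_pdivrMr ?ltr0n// mul1r ler_nat.
Qed.

Lemma C1_strict_diff V m n (g : V -> 'M[R]_(m, n)) (N : set V) a :
  finite_coords V -> open N -> N a -> C1_on N g -> strict_diff g ('d g a) a.
Proof.
move=> fV oN Na gC1; apply: strict_diff_mx => i j.
have dij y : N y -> is_diff y (fun v => g v i j : R^o) (fun v => 'd g y v i j).
  move=> Ny; have [dg _] := gC1 _ Ny.
  have dc (A : 'M[R]_(m, n)) :
      is_diff A (fun A : 'M[R]_(m, n) => A i j : R^o) (fun A => A i j).
    apply: DiffDef; first exact: differentiable_coord.
    have @f : {linear 'M[R]_(m, n) -> R^o}.
      by exists (fun N : 'M[R]_(_, _) => N i j); do 2![eexists];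
        do ?[constructor]; rewrite ?mxE// => ? *; rewrite ?mxE//; move=> ?;
        rewrite !mxE.
    by rewrite -[LHS]/('d f A : _ -> _) diff_lin//; exact: coord_continuous.
  have dg' : is_diff y g ('d g y) by [].
  exact: (is_diff_comp dg' (dc _)).
have -> : (fun v => 'd g a v i j : R^o) = 'd (fun v => g v i j : R^o) a.
  by have [_ ->] := dij _ Na.
apply: (C1_strict_diff_scalar fV oN Na) => y Ny; split.
  by have [] := dij _ Ny.
move=> v; have [_ /(_ v) cv] := gC1 _ Ny.
have : {for y, continuous (fun z => 'd g z v i j : R^o)}.
  exact: (cvg_comp _ _ cv (@coord_continuous _ _ _ i j ('d g y v))).
move=> /cvgrPdist_lt cvij; apply/cvgrPdist_lt => e /cvij.
have : \forall z \near y, N z by apply: open_nbhs_nbhs.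
apply: filterS2 => z Nz; have [_ ->] := dij _ Nz.
by have [_ ->] := dij _ Ny.
Qed.

End StrictDifferentiability.

(** * Local surjectivity on the nonnegative orthant *)

Section PositiveSpanning.
Variable R : realType.
Variable J : finType.
Implicit Types y b : J -> R.

(** The Euclidean norm of a family of reals: descent steps are estimated by
    expanding its square. *)
Definition enorm y : R := Num.sqrt (\sum_j y j ^+ 2).

Lemma enorm_ge0 y : 0 <= enorm y. Proof. exact: sqrtr_ge0. Qed.

Lemma sqr_enorm y : enorm y ^+ 2 = \sum_j y j ^+ 2.
Proof. by rewrite sqr_sqrtr// sumr_ge0// => j _; exact: sqr_ge0. Qed.

Lemma coord_le_enorm y j : `|y j| <= enorm y.
Proof.
rewrite -sqrtr_sqr ler_wsqrtr// (bigD1 j)//= lerDl sumr_ge0// => k _.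
exact: sqr_ge0.
Qed.

Lemma enorm_gt0 y j : y j != 0 -> 0 < enorm y.
Proof. by move=> yj; rewrite (lt_le_trans _ (coord_le_enorm y j))// normr_gt0. Qed.

Lemma enormZ (a : R) y : 0 <= a -> enorm (fun j => a * y j) = a * enorm y.
Proof.
move=> a0; rewrite -[in RHS](ger0_norm a0) -[in RHS]sqrtr_sqr -sqrtrM ?sqr_ge0//.
by congr Num.sqrt; rewrite mulr_sumr; apply: eq_bigr => j _; rewrite exprMn.
Qed.

Lemma sum_continuous (T : topologicalType) I (s : seq I) (F : I -> T -> R) x :
  (forall i, {for x, continuous (F i)}) ->
  {for x, continuous (fun t => \sum_(i <- s) F i t)}.
Proof.
move=> cF; elim: s => [|i s ih].
  have -> : (fun t => \sum_(i <- [::]) F i t) = cst 0.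
    by apply/funext => t; rewrite big_nil.
  exact: cst_continuous.
have -> : (fun t => \sum_(j <- i :: s) F j t) =
    (fun t => F i t + \sum_(j <- s) F j t).
  by apply/funext => t; rewrite big_cons.
exact: (continuousD (cF i) ih).
Qed.

Lemma enorm_continuous (T : topologicalType) (F : J -> T -> R) x :
  (forall j, {for x, continuous (F j)}) ->
  {for x, continuous (fun t => enorm (F ^~ t))}.
Proof.
move=> cF; apply: (@continuous_comp _ _ _ (fun t => \sum_j F j t ^+ 2) Num.sqrt).
  apply: sum_continuous => j.
  exact: (continuous_comp (cF j) (@exprn_continuous _ 2 _)).
exact: sqrt_continuous.
Qed.

(** Exact penalization. On a small box of nonnegative vectors, minimize
      enorm (g v - g 0 - b) + (1/4) * sum of the coordinates of v.
    Comparison with v = 0 keeps the minimizer away from the upper faces of the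
    box when b is small, so each of its coordinates can be increased. If the
    residual were nonzero, the spanning hypothesis, applied to minus the residual,
    would give a coordinate along which the norm of the residual decreases at a
    rate of at least 3/4 up to second order terms; as the penalty only grows at
    the rate 1/4, the minimizer could be improved. *)
Lemma local_surjectivity N (g L : J -> 'rV[R]_N -> R^o) :
  (forall j, strict_diff (g j) (L j) 0) ->
  (forall y, (exists j, y j != 0) ->
     exists i, enorm y <= \sum_j y j * L j (delta_mx 0 i)) ->
  forall rho : R, 0 < rho -> exists2 delta : R, 0 < delta &
    forall b, enorm b < delta -> exists lambda : 'rV[R]_N,
      [/\ forall i, 0 <= lambda 0 i, `|lambda| < rho
        & forall j, g j lambda = g j 0 + b j].
Proof.
move=> gL spanning rho rho0.
(* the errors e of the linearizations, summed over J, stay below 1/4 *)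
pose e : R := (4 * #|J|.+1%:R)^-1.
have e0 : 0 < e by rewrite invr_gt0 mulr_gt0.
have /choice[rj rjP] : forall j, exists r : R, 0 < r /\
    (forall v w, `|v| < r -> `|w| < r ->
      `|g j v - g j w - L j (v - w)| <= e * `|v - w|) /\
    (forall v, `|v| < r -> {for v, continuous (g j)}).
  move=> j; have [_ _ /(_ _ e0)[r r0 rP]] := gL j.
  have [r' r'0 cg] := strict_diff_near_continuous (gL j).
  exists (Num.min r r'); rewrite lt_min r0 r'0; split => //; split.
    move=> v w; rewrite !lt_min => /andP[vr _] /andP[wr _].
    by apply: rP; rewrite subr0.
  by move=> v; rewrite lt_min => /andP[_ vr]; apply: cg; rewrite subr0.
pose r := \big[Num.min/rho]_j rj j.
have r0 : 0 < r by apply/bigmin_gtP; split=> // j _; have [] := rjP j.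
have rrj j (v : 'rV[R]_N) : `|v| < r -> `|v| < rj j.
  by move=> /bigmin_gtP[_]; apply.
have r_rho : r <= rho by exact: bigmin_le_id.
pose B : set 'rV[R]_N := [set v | forall i, v ord0 i \in `[0, r / 2]].
have cB : compact B.
  by apply: (@rV_compact _ _ (fun=> `[0, r / 2]%classic)) => i; exact: segment_compact.
have B0 : B 0.
  by move=> i; rewrite in_itv/= mxE lexx divr_ge0// ltW.
have Br v : B v -> `|v| < r.
  move=> Bv; apply: (@le_lt_trans _ _ (r / 2)); last by lra.
  apply: mx_norm_le; first by rewrite divr_ge0// ltW.
  move=> i j; rewrite ord1; have := Bv j; rewrite in_itv/= => /andP[v0 v1].
  by rewrite ger0_norm.
exists (r / 8) => [|b br]; first by rewrite divr_gt0.
pose res (v : 'rV[R]_N) j := g j v - g j 0 - b j.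
pose Phi v := enorm (res v) + 1 / 4 * \sum_i v ord0 i.
have cPhi : {within B, continuous Phi}.
  apply: continuous_in_subspaceT => v /set_mem Bv.
  have cres : {for v, continuous (fun t => enorm (res t))}.
    apply: (@enorm_continuous _ (fun j t => res t j)) => j.
    have [_ [_ cg]] := rjP j.
    have cgv := cg _ (rrj j _ (Br _ Bv)).
    have cst0 (k : R) : {for v, continuous (fun=> k : R^o)}.
      exact: cst_continuous.
    exact: (continuousB (continuousB cgv (cst0 _)) (cst0 _)).
  have csum : {for v, continuous (fun t : 'rV[R]_N => \sum_i t ord0 i)}.
    by apply: sum_continuous => i; exact: coord_continuous.
  have cst4 : {for v, continuous (fun=> 1 / 4 : R)} by exact: cst_continuous.
  exact: (continuousD cres (continuousM cst4 csum)).
have [lam /set_mem Blam lam_min] :=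
  compact_EVT_min (ex_intro B 0 B0) cB cPhi.
have Phi0 : Phi 0 = enorm b.
  rewrite /Phi big1 ?mulr0 ?addr0; last by move=> i _; rewrite mxE.
  by congr Num.sqrt; apply: eq_bigr => j _; rewrite /res subrr sub0r sqrrN.
have lam0 i : 0 <= lam ord0 i by have := Blam i; rewrite in_itv/= => /andP[].
have lam_lt i : lam ord0 i < r / 2.
  have : Phi lam <= Phi 0 by apply: lam_min; rewrite inE.
  rewrite Phi0 /Phi (bigD1 i)//=.
  have := enorm_ge0 (res lam).
  have : 0 <= \sum_(k < N | k != i) lam ord0 k by rewrite sumr_ge0.
  by lra.
exists lam; split => //.
  by rewrite (lt_le_trans (Br _ Blam)).
suff res0 j : res lam j = 0.
  by move=> j; have := res0 j; rewrite /res; lra.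
apply/eqP/negPn/negP => resj.
(* a step of length s along the i-th axis will improve on lam *)
pose n := enorm (res lam).
have n0 : 0 < n by exact: enorm_gt0 resj.
have [|i] := spanning (fun j => - res lam j).
  by exists j; rewrite oppr_eq0.
set c := fun j => L j (delta_mx 0 i).
have -> : enorm (fun j => - res lam j) = n.
  by congr Num.sqrt; apply: eq_bigr => k _; rewrite sqrrN.
under eq_bigr do rewrite mulNr.
rewrite sumrN => nc.
pose M := 1 + \sum_j (`|c j| + e) ^+ 2.
have M1 : 1 <= M by rewrite lerDl sumr_ge0// => k _; exact: sqr_ge0.
(* s stays in the box, and makes the second order term s ^+ 2 * M at most
   s * n / 2 *)
pose s := Num.min (r / 2 - lam ord0 i) (n / (2 * M)).

have s0 : 0 < s by rewrite lt_min subr_gt0 lam_lt divr_gt0// mulr_gt0// (lt_le_trans _ M1).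
have [s_le s_n] : s <= r / 2 - lam ord0 i /\ s <= n / (2 * M).
  by rewrite !ge_min !lexx orbT.
pose lam' := lam + s *: delta_mx 0 i.
have lam'E k : lam' ord0 k = lam ord0 k + s * (k == i)%:R.
  by rewrite !mxE eqxx /= eq_sym.
have Blam' : B lam'.
  move=> k; rewrite lam'E; have := Blam k; rewrite !in_itv/=.
  have [->|_] := eqVneq k i; rewrite ?mulr1 ?mulr0 ?addr0// => /andP[? _].
  by apply/andP; split; lra.
pose eps j := (g j lam' - g j lam - s * c j) / s.
have epsE k : `|eps k| <= e.
  have [_ [+ _]] := rjP k.
  move=> /(_ _ _ (rrj k _ (Br _ Blam')) (rrj k _ (Br _ Blam))).
  rewrite [lam' - lam]addrAC subrr add0r normrZ gtr0_norm//.
  have -> : `|delta_mx 0 i : 'rV[R]_N| = 1.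
    apply/eqP; rewrite eq_le; apply/andP; split.
      by apply: mx_norm_le => // k' j'; rewrite mxE; case: (_ && _);
        rewrite ?normr1 ?normr0.
    by have := mx_coord_le (delta_mx 0 i : 'rV[R]_N) 0 i; rewrite mxE !eqxx normr1.
  have -> : L k (s *: delta_mx 0 i) = s * c k.
    have [LL _ _] := gL k; have := LL s (delta_mx 0 i) 0.
    by rewrite (_ : L k 0 = 0) ?addr0//; have := LL (-1) 0 0;
      rewrite scaler0 addr0 scaleN1r addNr.
  by rewrite mulr1 -ler_pdivrMr// /eps normrM (gtr0_norm (x := s^-1)) ?invr_gt0.
have res' k : res lam' k = res lam k + s * (c k + eps k).
  by rewrite /res /eps; field; rewrite lt0r_neq0.
have : Phi lam <= Phi lam' by apply: lam_min; rewrite inE.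
rewrite /Phi -/n.
have -> : \sum_k lam' ord0 k = \sum_k lam ord0 k + s.
  rewrite (eq_bigr _ (fun k _ => lam'E k)) big_split/= -mulr_sumr.
  rewrite [X in s * X](bigD1 i)//= eqxx [X in true%:R + X]big1 ?addr0 ?mulr1//.
  by move=> k /negPf->.
set S := \sum_k lam _ _ => nn'.
set n' := enorm (res lam') in nn'.
have {nn'}nn' : n - s / 4 <= n' by lra.
have sM : s * M <= n / 2.
  move: s_n; rewrite ler_pdivlMr ?mulr_gt0// ?(lt_le_trans _ M1)//.
  by lra.
have ns : 0 <= n - s / 4.
  have : s <= s * M by rewrite ler_pMr.
  by lra.
have : (n - s / 4) ^+ 2 <= n' ^+ 2 by rewrite ler_sqr ?nnegrE// enorm_ge0.
have -> : n' ^+ 2 = n ^+ 2 + 2 * s * \sum_k res lam k * (c k + eps k)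
    + s ^+ 2 * \sum_k (c k + eps k) ^+ 2.
  rewrite !sqr_enorm !mulr_sumr -!big_split/=; apply: eq_bigr => k _.
  by rewrite res'; ring.
have sum1 : \sum_k res lam k * (c k + eps k) <= - n + n / 4.
  have -> : \sum_k res lam k * (c k + eps k) =
      \sum_k res lam k * c k + \sum_k res lam k * eps k.
    by rewrite -big_split; apply: eq_bigr => k _; rewrite mulrDr.
  apply: lerD; first by lra.
  apply: (@le_trans _ _ (\sum_(k in J) n * e)).
    apply: ler_sum => k _; rewrite (le_trans (ler_norm _))// normrM.
    by apply: ler_pM => //; exact: coord_le_enorm.
  have eJ : e * #|J|%:R <= 1 / 4.
    rewrite mulrC ler_pdivrMr ?mulr_gt0// -[#|J|.+1%:R]natr1; move: (ler0n R #|J|); lra.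
  have nJ : n * (e * #|J|%:R) <= n * (1 / 4) by rewrite ler_pM2l.
  rewrite sumr_const -[leLHS]mulr_natr -[leLHS]mulrA (le_trans nJ)//.
  by rewrite mul1r.
have sum2 : \sum_k (c k + eps k) ^+ 2 <= M.
  apply: (@le_trans _ _ (\sum_k (`|c k| + e) ^+ 2)); last by rewrite lerDr.
  apply: ler_sum => k _; rewrite -[leLHS]real_normK ?num_real//.
  rewrite ler_sqr ?nnegrE ?addr_ge0// ?(ltW e0)//.
  by rewrite (le_trans (ler_normD _ _))// lerD.
move: sum1 sum2; set s1 := \sum_k _; set s2 := \sum_k _ => sum1 sum2.
have : s * s1 <= s * (- n + n / 4) by rewrite ler_pM2l.
have : s ^+ 2 * s2 <= s * (s * M) by rewrite expr2 -mulrA !ler_pM2l.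
have : s * (s * M) <= s * (n / 2) by rewrite ler_pM2l.
have : 0 < s * n by rewrite mulr_gt0.
have : 0 <= s ^+ 2 by exact: sqr_ge0.
by clear; move=> *; lra.
Qed.

End PositiveSpanning.

(** * Positively spanning families in convex cones *)

Section ConeAlternative.
Variable R : realType.
Variable J : finType.
Implicit Types y b : J -> R.

Lemma sphere_compact n :
  compact [set v : 'rV[R]_n | \sum_k v ord0 k ^+ 2 = 1].
Proof.
have cB : compact [set v : 'rV[R]_n | forall i, v ord0 i \in `[(-1 : R), 1]].
  by apply: (@rV_compact _ _ (fun=> `[(-1 : R), 1]%classic)) => i;
    exact: segment_compact.
apply: subclosed_compact cB _.
  apply: (@closed_comp _ _ (fun v : 'rV[R]_n => \sum_k v ord0 k ^+ 2) [set x | x = 1]).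
    move=> v _; apply: sum_continuous => i.
    apply: (@continuous_comp _ _ _ (fun v : 'rV[R]_n => v ord0 i)
      (fun x : R => x ^+ 2)).
      exact: coord_continuous.
    exact: exprn_continuous.
  exact: closed_eq.
move=> v /= v1 i; rewrite in_itv/= -ler_norml.
rewrite -[leLHS]ger0_norm// -[leRHS]normr1 -ler_sqr ?nnegrE// !normr_id.
rewrite normr1 expr1n real_normK ?num_real// -v1 (bigD1 i)//= lerDl.
by rewrite sumr_ge0// => k _; exact: sqr_ge0.
Qed.

(** For each p, the unit vectors y whose pairing with the image of p exceeds 1
    form an open set; by hypothesis these sets cover the unit sphere, so finitely
    many of them do. Homogeneity extends the bound to all y. *)
Lemma finite_positive_spanning (P : Type) (K : set P) (A : J -> P -> R) :
  (forall y, (exists j, y j != 0) ->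
     exists2 p, K p & enorm y < \sum_j y j * A j p) ->
  exists N (ks : 'I_N -> P), (forall i, K (ks i)) /\
    forall y, (exists j, y j != 0) ->
      exists i, enorm y <= \sum_j y j * A j (ks i).
Proof.
move=> KA; pose n := #|J|.
pose ry (v : 'rV[R]_n) : J -> R := fun j => v ord0 (enum_rank j).
have sumE (F : 'I_n -> R) : \sum_k F k = \sum_j F (enum_rank j).
  by rewrite (reindex_onto enum_rank enum_val) => [|k _];
    [apply: eq_bigl => j; rewrite enum_rankK eqxx | rewrite enum_valK].
have enry v : enorm (ry v) ^+ 2 = \sum_k v ord0 k ^+ 2.
  by rewrite sqr_enorm sumE.
have := @sphere_compact n; rewrite compact_cover.
pose D : set 'rV[R]_n := [set v | exists2 p, K p & forall j, ry v j = A j p].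
pose f (v : 'rV[R]_n) : set 'rV[R]_n := [set y | 1 < \sum_k y ord0 k * v ord0 k].
move=> /(_ _ D f)[].
- move=> v _; apply: (@open_comp _ _ (fun y : 'rV[R]_n => \sum_k y ord0 k * v ord0 k)
    [set x | 1 < x]); last exact: open_gt.
  move=> y _; apply: sum_continuous => i.
  apply: (@continuousM _ _ (fun y : 'rV[R]_n => y ord0 i) (cst (v ord0 i))).
    exact: coord_continuous.
  exact: cst_continuous.
- move=> v /= v1; have en1 : enorm (ry v) = 1.
    apply/eqP; rewrite -(@eqrXn2 _ 2%N)// ?enorm_ge0//.
    by rewrite enry v1 expr1n.
  have [|p Kp vp] := KA (ry v).
    apply: contrapT => /forallNP v0; have := enry v; rewrite v1 sqr_enorm.
    rewrite big1 => [/esym/eqP|j _]; first by rewrite oner_eq0.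
    by have /negP := v0 j; rewrite negbK => /eqP->; rewrite expr0n.
  exists (\row_k A (enum_val k) p) => /=.
    by exists p => // j; rewrite /ry mxE enum_rankK.
  rewrite /f/= sumE; move: vp; rewrite en1.
  by under [X in _ < X -> _]eq_bigr do rewrite -[X in A X]enum_rankK -/(ry v) /ry;
   under [X in _ -> _ < X]eq_bigr do rewrite mxE.
move=> D' D'D cov; pose l : seq 'rV[R]_n := enum_fset D'.
have /choice[ks ksP] : forall i : 'I_(size l), exists p,
    K p /\ forall j, ry (nth 0 l i) j = A j p.
  move=> i; have /D'D : nth 0 l i \in D' by exact: mem_nth.
  by rewrite inE => -[p Kp Ep]; exists p.
exists (size l), ks; split=> [i|y y0]; first by have [] := ksP i.
have yp : 0 < enorm y by have [j /enorm_gt0] := y0.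
pose v : 'rV[R]_n := \row_k (y (enum_val k) / enorm y).
have [|w /= D'w] := cov v.
  rewrite /= sumE.
  have -> : \sum_j v ord0 (enum_rank j) ^+ 2 = \sum_j y j ^+ 2 / enorm y ^+ 2.
    by apply: eq_bigr => j _; rewrite mxE enum_rankK exprMn exprVn.
  by rewrite -mulr_suml -sqr_enorm divff// expf_neq0// lt0r_neq0.
have wl : w \in l by [].
rewrite /f/= sumE.
have [_ wE] := ksP (Ordinal (etrans (index_mem w l) wl)).
rewrite /= nth_index// in wE => lt1.
exists (Ordinal (etrans (index_mem w l) wl)); apply: ltW.
have : enorm y * 1 < enorm y * (\sum_j v ord0 (enum_rank j) * w ord0 (enum_rank j)).
  by rewrite ltr_pM2l.
rewrite mulr1 => /lt_le_trans; apply; rewrite mulr_sumr; apply: ler_sum => j _.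
rewrite -wE /ry mxE enum_rankK mulrA [enorm y * _]mulrC divfK ?lexx//.
exact: lt0r_neq0.
Qed.

(** The zero vector is reached from inside: local_surjectivity, applied to the
    linear map itself, writes minus a small multiple of the sum of the images of
    the family as a combination with nonnegative coefficients lambda, so z can be
    taken to be a combination of the family with positive coefficients. Adding
    multiples of z moves a vector within K without changing its image. *)
Lemma positive_spanning_with_zero (P : lmodType R) (K : set P)
    (A : J -> P -> R^o) (j0 : J) :
  (forall j, linear (A j)) ->
  (forall p q, K p -> K q -> K (p + q)) ->
  (forall (a : R) p, 0 < a -> K p -> K (a *: p)) ->
  (forall y, (exists j, y j != 0) ->
     exists2 p, K p & 0 < \sum_j y j * A j p) ->
  exists N (ks : 'I_N -> P), [/\ forall i, K (ks i),
    forall y, (exists j, y j != 0) ->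
      exists i, enorm y <= \sum_j y j * A j (ks i)
    & exists2 z, K z & forall j, A j z = 0].
Proof.
move=> AL KD KZ KA.
have A0 j : A j 0 = 0.
  by have := AL j (-1) 0 0; rewrite scaler0 addr0 scaleN1r addNr.
have AZ j (a : R) p : A j (a *: p) = a * A j p.
  by have := AL j a p 0; rewrite A0 !addr0.
have AD j p q : A j (p + q) = A j p + A j q.
  by have := AL j 1 p q; rewrite !scale1r.
have Asum j (I : Type) (s : seq I) (F : I -> P) :
    A j (\sum_(i <- s) F i) = \sum_(i <- s) A j (F i).
  by elim: s => [|i s ih]; rewrite ?big_nil// !big_cons AD ih.
have [N [ks [Kks span]]] : exists N (ks : 'I_N -> P), (forall i, K (ks i)) /\
    forall y, (exists j, y j != 0) ->
      exists i, enorm y <= \sum_j y j * A j (ks i).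
  apply: finite_positive_spanning => y y0; have [p Kp yp] := KA _ y0.
  (* K is a cone: p is rescaled so that its pairing with y exceeds enorm y *)
  set d := \sum_j _ in yp; pose a := (enorm y + 1) / d.
  have en1 : 0 < enorm y + 1 by rewrite ltr_wpDl// enorm_ge0.
  exists (a *: p); first by apply: KZ => //; rewrite divr_gt0.
  have -> : \sum_j y j * A j (a *: p) = a * d.
    by rewrite mulr_sumr; apply: eq_bigr => j _; rewrite AZ mulrCA.
  by rewrite /a divfK ?lt0r_neq0// ltrDl.
exists N, ks; split=> //.
pose L j (v : 'rV[R]_N) : R^o := \sum_i v ord0 i * A j (ks i).
have Ld j i : L j (delta_mx 0 i) = A j (ks i).
  rewrite /L (bigD1 i)//= mxE !eqxx mul1r big1 ?addr0// => k ki.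
  by rewrite mxE eqxx (negPf ki) mul0r.
have LL j : linear (L j).
  move=> k v w; rewrite /L scaler_sumr -big_split/=; apply: eq_bigr => i _.
  by rewrite !mxE mulrDl -mulrA.
have [||delta delta0 sol] := @local_surjectivity R J N L L _ _ 1 ltr01.
- by move=> j; apply: strict_diff_linear (LL j); exact: finite_coords_mx.
- by move=> y /span[i yi]; exists i; under eq_bigr do rewrite Ld.
pose s j : R := \sum_i A j (ks i).
pose eta := delta / (2 * (1 + enorm s)).
have es1 : 0 < 1 + enorm s by rewrite ltr_pwDl// enorm_ge0.
have eta0 : 0 < eta by rewrite divr_gt0// mulr_gt0.
have [|lam [lam0 _ lamE]] := sol (fun j => - (eta * s j)).
  have -> : enorm (fun j => - (eta * s j)) = eta * enorm s.
    rewrite -enormZ ?ltW//; congr Num.sqrt; apply: eq_bigr => j _.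
    by rewrite sqrrN.
  rewrite /eta mulrAC ltr_pdivrMr ?mulr_gt0// ltr_pM2l//.
  by have := enorm_ge0 s; lra.
exists (\sum_i (lam 0 i + eta) *: ks i); last first.
  move=> j; rewrite Asum.
  under eq_bigr do rewrite AZ mulrDl.
  rewrite big_split/= -mulr_sumr; have := lamE j; rewrite /L => ->.
  by rewrite big1 ?add0r ?addNr// => i _; rewrite mxE mul0r.
have [|i0 _] := span (fun j => (j == j0)%:R).
  by exists j0; rewrite eqxx oner_eq0.
have {i0}N0 : (0 < N)%N by rewrite (leq_ltn_trans _ (ltn_ord i0)).
have Ksum n (p : 'I_n -> P) : (0 < n)%N -> (forall i, K (p i)) -> K (\sum_i p i).
  elim: n p => // -[|n] ih p _ Kp; first by rewrite big_ord_recr big_ord0/= add0r.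
  by rewrite big_ord_recr/=; apply: KD => //; exact: ih.
by apply: Ksum => // i; apply: KZ; rewrite ?ltr_wpDl.
Qed.

End ConeAlternative.

(** * Convex cones and their relative interiors *)

Section ConvexCones.
Variables (R : realType) (n : nat).
Implicit Types (v w p q o : 'cV[R]_n) (A K Q : set 'cV[R]_n).

Lemma affine_aff K : affine_set (aff K).
Proof. by move=> y z a Ky Kz A AK; apply: (AK.1); [apply: Ky|apply: Kz]. Qed.

Lemma sub_aff K : K `<=` aff K.
Proof. exact: sub_gen_smallest. Qed.

Lemma affine_translate A p q o (t : R) : affine_set A -> A p -> A q -> A o ->
  A (p + t *: (q - o)).
Proof.
move=> aA Ap Aq Ao.
(* p + t (q - o) is the midpoint of 2 p - o and 2 t q + (1 - 2 t) o *)
have Ar := aA q o (2 * t) Aq Ao.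
have As := aA p o 2 Ap Ao.
have := aA _ _ 2^-1 As Ar; congr A.
by apply/matrixP => i j; rewrite !mxE; field.
Qed.

Lemma cone_vertex v K : convex_cone_at v K -> K v.
Proof.
move=> [[K' [[w K'w] K'Z ->]] _]; exists (0 *: w); first exact: K'Z.
by rewrite scale0r addr0.
Qed.

Lemma cone_dirZ v K w (a : R) :
  convex_cone_at v K -> 0 <= a -> K (v + w) -> K (v + a *: w).
Proof.
move=> [[K' [_ K'Z ->]] _] a0 [w' K'w' /addrI<-].
by exists (a *: w') => //; exact: K'Z.
Qed.

Lemma cone_dirD v K w w' :
  convex_cone_at v K -> K (v + w) -> K (v + w') -> K (v + (w + w')).
Proof.
move=> cK Kw Kw'; have [_ conv] := cK.
have h : 0 <= (2^-1 : R) <= 1 by apply/andP; split; lra.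
have K2 := cone_dirZ cK (ler0n R 2) Kw.
have K2' := cone_dirZ cK (ler0n R 2) Kw'.
have := conv _ _ (Itv01 (andP h).1 (andP h).2) (mem_set K2) (mem_set K2').
rewrite inE; congr K.
by apply/matrixP => i j; rewrite !mxE /=/unstable.onem; field.
Qed.

Lemma cone_dir_sum v K (I : Type) (s : seq I) (w : I -> 'cV[R]_n) (a : I -> R) :
  convex_cone_at v K -> (forall i, 0 <= a i) -> (forall i, K (v + w i)) ->
  K (v + \sum_(i <- s) a i *: w i).
Proof.
move=> cK a0 Kw; elim: s => [|i s ih].
  by rewrite big_nil addr0; exact: cone_vertex.
by rewrite big_cons; apply: cone_dirD => //; apply: cone_dirZ.
Qed.

(** Homotheties centred at the vertex preserve both K and its affine hull. *)
Lemma relint_dirZ v K w (a : R) :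
  convex_cone_at v K -> 0 < a -> relint K (v + w) -> relint K (v + a *: w).
Proof.
move=> cK a0 [Kw [e e0 eK]]; split; first by apply: cone_dirZ => //; exact: ltW.
exists (a * e) => [|y]; first exact: mulr_gt0.
have affv := sub_aff (cone_vertex cK).
rewrite -ball_normE /= => -[ye affy].
have : K (v + a^-1 *: (y - v)).
  apply: eK; rewrite -ball_normE; split => /=; last first.
    exact: (affine_translate _ (@affine_aff K) affv affy affv).
  have -> : v + w - (v + a^-1 *: (y - v)) = a^-1 *: (v + a *: w - y).
    by apply/matrixP => i j; rewrite !mxE; field; rewrite lt0r_neq0.
  by rewrite normrZ gtr0_norm ?invr_gt0// ltr_pdivrMl.
move=> /(cone_dirZ cK (ltW a0)).
by rewrite scalerA divff ?lt0r_neq0// scale1r addrC subrK.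
Qed.

(** The translation by w' maps K into itself, and its inverse preserves the affine
    hull: a relative neighbourhood of v + w is carried to one of v + (w + w'). *)
Lemma relint_dirD v K w w' : convex_cone_at v K ->
  relint K (v + w) -> K (v + w') -> relint K (v + (w + w')).
Proof.
move=> cK [Kw [e e0 eK]] Kw'; split; first exact: cone_dirD.
exists e => // y; rewrite -ball_normE /= => -[ye affy].
have : K (v + (y - w' - v)).
  rewrite addrC subrK; apply: eK; rewrite -ball_normE; split => /=.
    have -> : v + w - (y - w') = v + (w + w') - y.
      by apply/matrixP => i j; rewrite !mxE; ring.
    by [].
  have -> : y - w' = y + (-1) *: ((v + w') - v).
    by apply/matrixP => i j; rewrite !mxE; ring.
  exact: (affine_translate _ (@affine_aff K) affy (sub_aff Kw')
    (sub_aff (cone_vertex cK))).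
move=> /(cone_dirD cK Kw'); congr K.
by apply/matrixP => i j; rewrite !mxE; ring.
Qed.

(** A smaller cone Q with the same affine hull as K captures every direction of K
    once it is tilted towards an interior direction z of Q: w / M' becomes small,
    and Q is invariant under the scaling by M'. *)
Lemma relint_absorbs v K Q z w : convex_cone_at v Q -> aff Q = aff K ->
  K v -> relint Q (v + z) -> K (v + w) ->
  exists2 M : R, 0 < M & forall M', M <= M' -> Q (v + (M' *: z + w)).
Proof.
move=> cQ affE Kv [Qz [e e0 eQ]] Kw.
exists ((1 + `|w|) / e); first by rewrite divr_gt0// ltr_pwDl.
move=> M' MM'; have M'0 : 0 < M'.
  by rewrite (lt_le_trans _ MM')// divr_gt0// ltr_pwDl.
have -> : M' *: z + w = M' *: (z + M'^-1 *: w).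
  by rewrite scalerDr scalerA divff ?lt0r_neq0// scale1r.
apply: (cone_dirZ cQ (ltW M'0)).
apply: eQ; rewrite -ball_normE; split => /=.
  rewrite addrA opprD addNKr normrN normrZ gtr0_norm ?invr_gt0//.
  rewrite ltr_pdivrMl//; move: MM'; rewrite ler_pdivrMr//; lra.
have -> : v + (z + M'^-1 *: w) = v + z + M'^-1 *: ((v + w) - v).
  by rewrite addrA [v + w]addrC addrK.
have affw := sub_aff Kw; have affv := sub_aff Kv.
have affz := sub_aff Qz; rewrite -affE in affw affv.
exact: (affine_translate _ (@affine_aff Q) affz affw affv).
Qed.

(** The sum z of a maximal free family of directions of K works: a point of the
    affine hull close to v + z has coordinates close to 1 in that family, hence
    positive ones. *)
Lemma relint_neq0 v K : convex_cone_at v K -> exists w, relint K (v + w).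
Proof.
move=> cK.
pose P r := `[< exists B : 'M[R]_(r, n), row_free B /\
  forall i, K (v + (row i B)^T) >].
have P0 : exists r, P r.
  exists 0%N; apply/asboolP; exists 0; split; last by case.
  by rewrite /row_free mxrank0.
have Pn r : P r -> (r <= n)%N.
  by move=> /asboolP[B [/eqP rB _]]; rewrite -rB; exact: rank_leq_col.
case: (ex_maxnP P0 Pn) => r /asboolP[B [freeB KB]] maxr.
have spanB w : K (v + w) -> (w^T <= B)%MS.
  move=> Kw; apply: contrapT => /negP wB.
  suff : P (r + 1)%N by move=> /maxr; rewrite addn1 ltnn.
  apply/asboolP; exists (col_mx B w^T); split.
    have sB : (B <= col_mx B w^T)%MS.
      by have := submx_refl (col_mx B w^T); rewrite col_mx_sub => /andP[].
    have [ler eqr] := mxrank_leqif_sup sB.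
    have lt_r : (r < \rank (col_mx B w^T))%N.
      rewrite (eqP freeB) in ler eqr.
      rewrite ltn_neqAle ler andbT eqr; apply: contra wB.
      by rewrite col_mx_sub => /andP[].
    by rewrite /row_free eqn_leq rank_leq_row/= (leq_trans _ lt_r)// addn1.
  move=> i; case: (splitP i) => j ij.
    have -> : i = lshift 1 j by exact: val_inj.
    by rewrite rowKu.
  have -> : i = rshift r j by exact: val_inj.
  by rewrite rowKd row_id trmxK.
pose z := \sum_i (row i B)^T; exists z.
have Kcomb (c : 'I_r -> R) : (forall i, 0 <= c i) ->
  K (v + \sum_i c i *: (row i B)^T) by move=> c0; exact: cone_dir_sum.
have zE : z = \sum_i 1 *: (row i B)^T.
  by apply: eq_bigr => i _; rewrite scale1r.
split; first by rewrite zE; apply: Kcomb.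
pose L (w : 'cV[R]_n) := w^T *m pinvmx B.
have LL : linear L by move=> k y y'; rewrite /L linearP/= mulmxDl scalemxAl.
have [C C0 LC] := finite_coords_linear_bounded LL (finite_coords_mx R n 1).
have LB c : L (\sum_i c i *: (row i B)^T) = \row_i c i.
  rewrite /L (_ : trmx _ = (\row_i c i) *m B) ?mulmxKp// mulmx_sum_row linear_sum.
  by apply: eq_bigr => i _; rewrite linearZ/= trmxK mxE.
exists C^-1; rewrite ?invr_gt0// => y; rewrite -ball_normE /= => -[yz affy].
have yB : ((y - v)^T <= B)%MS.
  have : aff K `<=` [set y | ((y - v)^T <= B)%MS].
    apply: smallest_sub.
      move=> p q a /= pB qB.
      have -> : a *: p + (1 - a) *: q - v = a *: (p - v) + (1 - a) *: (q - v).
        by apply/matrixP => i j; rewrite !mxE; ring.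
      rewrite linearD !linearZ/=; apply: addmx_sub; exact: scalemx_sub.
    by move=> p Kp /=; apply: spanB; rewrite addrC subrK.
  by move=> /(_ _ affy).
have yE : y = v + \sum_i L (y - v) 0 i *: (row i B)^T.
  have : (y - v)^T = \sum_i L (y - v) 0 i *: row i B.
    by rewrite -mulmx_sum_row mulmxKpV.
  move=> /(congr1 trmx); rewrite trmxK linear_sum => yv.
  rewrite -[LHS](subrK v) [X in X + v]yv addrC; congr (_ + _).
  by apply: eq_bigr => i _; rewrite linearZ/=.
rewrite yE; apply: Kcomb => i.
have : `|L (v + z - y) 0 i| <= C * `|v + z - y|.
  exact: le_trans (mx_coord_le _ _ _) (LC _).
have -> : v + z - y = z - (y - v) by rewrite opprB addrA [z + v]addrC.
have Lz : L z = \row_i 1 by rewrite zE LB.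
rewrite (linear_morphB LL) Lz !mxE => le1.
have : C * `|z - (y - v)| < 1.
  by rewrite -ltr_pdivlMl// mulr1 opprB addrA [z + v]addrC.
move=> /(le_lt_trans le1); rewrite ltr_norml => /andP[_]; lra.
Qed.

End ConvexCones.

(** * Gradients, tents and the Hamiltonian *)

Section Gradients.
Variable R : realType.

Lemma strict_diff_is_diff (V W : normedModType R) (h L : V -> W) a :
  strict_diff h L a -> is_diff a h L.
Proof.
move=> [LL [C C0 LC] hL].
pose lL := GRing.isLinear.Build _ _ _ _ L LL.
pose L' : {linear V -> W} := HB.pack L lL.
have cL : continuous L'.
  apply/linear_bounded_continuous; apply/bounded_funP => r.
  exists (C * r) => v vr; rewrite (le_trans (LC v))// ler_wpM2l// ltW//.
have exp : h \o shift a = cst (h a) + L' +o_ 0 id.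
  apply/eqaddoP => _/posnumP[e].
  have [r r0 hr] := hL _ (gt0 e).
  apply/nbhs_ballP; exists r => //= v; rewrite -ball_normE /= sub0r normrN => vr.
  have := hr (v + a) a; rewrite addrK subrr normr0 => /(_ vr r0).
  by rewrite -addrA -opprD.
have dE := diff_unique cL exp.
apply: DiffDef; last exact: dE.
by apply/diff_locallyP; rewrite dE; split.
Qed.

Lemma dot_grad n (g : 'cV[R]_n -> R^o) x v :
  differentiable g x -> dot (grad g x) v = 'd g x v.
Proof.
move=> dg; rewrite [in RHS](matrix_sum_delta v) linear_sum /dot.
apply: eq_bigr => i _; rewrite big_ord1 linearZ mxE deriveE//.
by rewrite [LHS]mulrC.
Qed.

Lemma dot_linear n (y : 'cV[R]_n) : linear (dot y : _ -> R^o).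
Proof.
move=> k v w; rewrite /dot scaler_sumr -big_split/=; apply: eq_bigr => i _.
by rewrite !mxE mulrDr mulrCA.
Qed.

Lemma dotC n (y z : 'cV[R]_n) : dot y z = dot z y.
Proof. by apply: eq_bigr => i _; rewrite mulrC. Qed.

Lemma grad_eq n (g : 'cV[R]_n -> R^o) x w :
  strict_diff g (dot w) x -> grad g x = w.
Proof.
move=> /strict_diff_is_diff dg; apply/matrixP => i j; rewrite ord1 mxE.
rewrite deriveE// diff_val /dot (bigD1 i)//= mxE !eqxx mulr1 big1 ?addr0// => k ki.
by rewrite mxE (negPf ki) mulr0.
Qed.

(** The condition psi z = z + o(z - v) says that the derivative of psi at v is the
    identity; since psi is C1, it is a strict derivative. *)
Lemma tent_strict n (Omega : set 'cV[R]_n) v Q : tent Omega v Q ->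
  exists psi : 'cV[R]_n -> 'cV[R]_n, [/\ psi v = v, strict_diff psi id v &
    exists2 e : R, 0 < e & forall w, Q (v + w) -> `|w| < e -> Omega (psi (v + w))].
Proof.
move=> [Ov cQ [psi [[N [oN Nv psiC1]] psio [e e0 Qpsi]]]]; exists psi.
have small : forall eps : R, 0 < eps ->
    \forall z \near v, `|psi z - z| <= eps * `|z - v|.
  move=> eps eps0.
  have /eqaddoP/(_ eps eps0) : psi = id +o_ (nbhs v) (fun z => z - v).
    by apply/funext => z; exact: psio.
  by [].
have psiv : psi v = v.
  have := nbhs_singleton (small 1 ltr01).
  by rewrite subrr normr0 mulr0 normr_le0 subr_eq0 => /eqP.
split=> //; last first.
  exists e => // w Qw we; apply: Qpsi => //.
  by rewrite -ball_normE /= opprD addNKr normrN.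
have sd := C1_strict_diff (@finite_coords_mx R n 1) oN Nv psiC1.
have dE : 'd psi v = idfun :> (_ -> _).
  apply: diff_unique; first by move=> z; exact: cvg_id.
  apply/eqaddoP => eps eps0.
  have /nbhs_ballP[r /= r0 hr] := small eps eps0.
  apply/nbhs_ballP; exists r => //= w; rewrite -ball_normE /= sub0r normrN => wr.
  have := hr (w + v); rewrite -ball_normE /= opprD addrCA subrr addr0 normrN.
  move=> /(_ wr); rewrite addrK => le_eps.
  by rewrite -[X in `|X|]/(psi (w + v) - (psi v + w)) psiv [v + w]addrC opprD.
by rewrite dE in sd.
Qed.

Lemma continuously_differentiable_strict d m p (h : 'cV[R]_d * 'cV[R]_m -> 'cV[R]_p) a :
  continuously_differentiable h -> strict_diff h ('d h a) a.
Proof.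
move=> hC1; apply: C1_strict_diff openT _ hC1 => //.
by apply: finite_coords_prod; exact: finite_coords_mx.
Qed.

Lemma continuously_differentiable_strict_scalar d m (h : 'cV[R]_d * 'cV[R]_m -> R^o) a :
  continuously_differentiable h -> strict_diff h ('d h a) a.
Proof.
move=> hC1; apply: C1_strict_diff_scalar openT _ hC1 => //.
by apply: finite_coords_prod; exact: finite_coords_mx.
Qed.

Lemma strict_diff_dot (V : normedModType R) n (w : 'cV[R]_n) (h L : V -> 'cV[R]_n) a :
  strict_diff h L a ->
  strict_diff (fun v => dot w (h v) : R^o) (fun v => dot w (L v) : R^o) a.
Proof.
move=> hL; apply: (strict_diff_comp hL).
exact: strict_diff_linear (finite_coords_mx R n 1) (dot_linear w).
Qed.

Lemma strict_diff_scale (V : normedModType R) (k : R) (h L : V -> R^o) a :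
  strict_diff h L a ->
  strict_diff (fun v => k * h v : R^o) (fun v => k * L v : R^o) a.
Proof.
move=> hL; apply: (strict_diff_comp (g := fun r : R^o => k * r : R^o)
  (M := fun r : R^o => k * r : R^o) hL).
apply: strict_diff_eq (strict_diff_affine 0 (h a) _ _) => [r|r||].
- exact: add0r.
- reflexivity.
- by move=> l y z; rewrite mulrDr scalerAr.
- by exists (1 + `|k|) => [|r]; rewrite ?ltr_pwDl// normrM mulrDl mul1r lerDr.
Qed.

Lemma strict_diff_id (V : normedModType R) (a : V) : strict_diff id id a.
Proof.
split=> //; first by exists 1 => // v; rewrite mul1r.
by move=> e e0; exists 1 => // y z _ _; rewrite subrr normr0 mulr_ge0// ltW.
Qed.

End Gradients.

Section HamiltonianGradients.
Variables (R : realType) (T d m : nat).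
Variables (f : 'I_T -> 'cV[R]_d * 'cV[R]_m -> 'cV[R]_d)
          (c : 'I_T -> 'cV[R]_d * 'cV[R]_m -> R^o)
          (W : 'I_m -> {set 'I_T}).
Hypothesis f_C1 : forall t : 'I_T, continuously_differentiable (f t).
Hypothesis c_C1 : forall t : 'I_T, continuously_differentiable (c t).
Variables (theta : R) (gamma : 'cV[R]_(freq_dim R W)) (zeta : 'cV[R]_d)
  (s : 'I_T) (xi : 'cV[R]_d) (mu : 'cV[R]_m).

Let H := hamiltonian f c W theta gamma.

Lemma grad_adjoint : grad (fun z => H z s xi mu) zeta = f s (xi, mu).
Proof.
apply: grad_eq.
pose k := theta * c s (xi, mu) + dot gamma (freq_block R W s *m mu).
apply: strict_diff_eq (strict_diffB
  (strict_diff_linear zeta (finite_coords_mx R d 1) (dot_linear (f s (xi, mu))))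
  (strict_diff_cst (k : R^o) zeta)) => [z|z].
  by rewrite /H /hamiltonian /k opprD addrA dotC.
by rewrite subr0.
Qed.

Lemma dot_grad_state v :
  dot (grad (fun z => H zeta s z mu) xi) v =
  dot zeta ('d (f s) (xi, mu) (v, 0)) - theta * 'd (c s) (xi, mu) (v, 0).
Proof.
have sp : strict_diff (fun z : 'cV[R]_d => (z, mu)) (fun z => (z, 0)) xi.
  exact: strict_diff_pair (strict_diff_id xi) (strict_diff_cst mu xi).
have sf := strict_diff_dot zeta (strict_diff_comp sp (continuously_differentiable_strict (xi, mu) (f_C1 s))).
have sc := strict_diff_scale theta
  (strict_diff_comp sp (continuously_differentiable_strict_scalar (xi, mu) (c_C1 s))).
have sH := strict_diffB (strict_diffB sf sc)
  (strict_diff_cst (dot gamma (freq_block R W s *m mu) : R^o) xi).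
have dH := strict_diff_is_diff sH.
rewrite dot_grad; last exact: (@ex_diff _ _ _ _ _ _ _ dH).
by rewrite (@diff_val _ _ _ _ _ _ _ dH)/= subr0.
Qed.

Lemma dot_grad_control v :
  dot (grad (fun z => H zeta s xi z) mu) v =
  dot zeta ('d (f s) (xi, mu) (0, v)) - theta * 'd (c s) (xi, mu) (0, v)
  - dot gamma (freq_block R W s *m v).
Proof.
have sp : strict_diff (fun z : 'cV[R]_m => (xi, z)) (fun z => (0, z)) mu.
  exact: strict_diff_pair (strict_diff_cst xi mu) (strict_diff_id mu).
have sf := strict_diff_dot zeta (strict_diff_comp sp (continuously_differentiable_strict (xi, mu) (f_C1 s))).
have sc := strict_diff_scale theta
  (strict_diff_comp sp (continuously_differentiable_strict_scalar (xi, mu) (c_C1 s))).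
have FL : linear (fun z : 'cV[R]_m => freq_block R W s *m z).
  by move=> k y z; rewrite linearP.
have sF := strict_diff_dot gamma (strict_diff_linear mu (finite_coords_mx R m 1) FL).
have dH := strict_diff_is_diff (strict_diffB (strict_diffB sf sc) sF).
rewrite dot_grad; last exact: (@ex_diff _ _ _ _ _ _ _ dH).
by rewrite (@diff_val _ _ _ _ _ _ _ dH).
Qed.

End HamiltonianGradients.

(** * Variations, multipliers and the maximum principle *)

Section MaximumPrinciple.
Variables (R : realType) (T d m : nat).
Variables (f : 'I_T -> 'cV[R]_d * 'cV[R]_m -> 'cV[R]_d)
          (c : 'I_T -> 'cV[R]_d * 'cV[R]_m -> R^o)
          (S : 'I_T.+1 -> set 'cV[R]_d) (U : 'I_T -> set 'cV[R]_m)
          (W : 'I_m -> {set 'I_T}).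
Hypothesis f_C1 : forall t : 'I_T, continuously_differentiable (f t).
Hypothesis c_C1 : forall t : 'I_T, continuously_differentiable (c t).
Variables (x : 'I_T.+1 -> 'cV[R]_d) (u : 'I_T -> 'cV[R]_m).
Hypothesis xu_optimal : optimal f c S U W x u.
Variables (qx : 'I_T.+1 -> set 'cV[R]_d) (qu : 'I_T -> set 'cV[R]_m).
Hypothesis qx_tent : forall t : 'I_T.+1, tent (S t) (x t) (qx t).
Hypothesis qu_local_tent : forall t : 'I_T, local_tent (U t) (u t) (qu t).

Notation F := (freq_block R W).
Notation xu t := (x (at_time t), u t).

(** The components of the residual: one for each coordinate of the dynamics at
    each time, one for each frequency constraint, and one for the cost. *)
Definition constraint : finType := ('I_T * 'I_d + 'I_(freq_dim R W) + unit)%type.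

(** A state variation, a control variation, and a slack added to the cost. The
    slack stands for the fact that only a decrease of the cost is impossible; it
    fixes the sign of the cost multiplier. *)
Definition variation : lmodType R :=
  (('I_T.+1 -> 'cV[R]_d) * ('I_T -> 'cV[R]_m) * R^o)%type.

Definition linearized (j : constraint) (p : variation) : R^o :=
  match j with
  | inl (inl (t, i)) =>
      (p.1.1 (at_succ t) - 'd (f t) (xu t) (p.1.1 (at_time t), p.1.2 t)) i 0
  | inl (inr a) => (\sum_t F t *m p.1.2 t) a 0
  | inr _ => \sum_t 'd (c t) (xu t) (p.1.1 (at_time t), p.1.2 t) + p.2
  end.

Definition admissible : set variation := fun p =>
  [/\ forall t, qx t (x t + p.1.1 t), forall t, qu t (u t + p.1.2 t)
    & 0 <= p.2].

(** Controls move in the relative interiors: only those directions are covered by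
    the tents that make up a local tent. *)
Definition inner_admissible : set variation := fun p =>
  [/\ forall t, qx t (x t + p.1.1 t), forall t, relint (qu t) (u t + p.1.2 t)
    & 0 <= p.2].

Lemma linearized_linear j : linear (linearized j).
Proof.
move=> k p q; case: j => [[[t i]|a]|[]] /=.
- rewrite -[X in 'd _ _ X]/(k *: (p.1.1 (at_time t), p.1.2 t) +
    (q.1.1 (at_time t), q.1.2 t)) linearP.
  rewrite -[X in X - _]/(k *: p.1.1 (at_succ t) + q.1.1 (at_succ t)).
  by rewrite !mxE [in RHS]/GRing.scale/=; ring.
- rewrite !summxE scaler_sumr -big_split; apply: eq_bigr => t _ /=.
  by rewrite linearP !mxE.
rewrite scalerDr addrACA; congr (_ + _).
rewrite scaler_sumr -big_split; apply: eq_bigr => t _ /=.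
by rewrite -[X in 'd _ _ X]/(k *: (p.1.1 (at_time t), p.1.2 t) +
    (q.1.1 (at_time t), q.1.2 t)) linearP.
Qed.

Let qx_cone t : convex_cone_at (x t) (qx t). Proof. by have [] := qx_tent t. Qed.
Let qu_cone t : convex_cone_at (u t) (qu t).
Proof. by have [] := qu_local_tent t. Qed.

Lemma inner_admissibleD p q :
  inner_admissible p -> admissible q -> inner_admissible (p + q).
Proof.
move=> [px pu p0] [qx' qu' q0]; split=> [t|t|].
- exact: (cone_dirD (qx_cone t)).
- exact: (relint_dirD (qu_cone t)).
- exact: addr_ge0.
Qed.

Lemma inner_admissibleZ (a : R) p :
  0 < a -> inner_admissible p -> inner_admissible (a *: p).
Proof.
move=> a0 [px pu p0]; split=> [t|t|].
- exact: (cone_dirZ (qx_cone t) (ltW a0)).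
- exact: (relint_dirZ (qu_cone t)).
- by rewrite mulr_ge0// ltW.
Qed.

Lemma inner_admissible_sub p : inner_admissible p -> admissible p.
Proof. by move=> [px pu p0]; split=> // t; have [] := pu t. Qed.

Lemma sum_variation (I : Type) (s : seq I) (a : I -> R) (k : I -> variation) :
  \sum_(i <- s) a i *: k i =
  ((fun t => \sum_(i <- s) a i *: (k i).1.1 t,
    fun t => \sum_(i <- s) a i *: (k i).1.2 t), \sum_(i <- s) a i * (k i).2).
Proof.
elim: s => [|i s ih].
  rewrite big_nil; congr (_, _, _); rewrite ?big_nil//;
    by apply/funext => t; rewrite big_nil.
rewrite big_cons ih; congr (_, _, _); rewrite ?big_cons//;
  by apply/funext => t; rewrite big_cons.
Qed.

(** A single tent Q t of U t has to contain the control directions of the whole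
    family ks. The interior direction z selects it, and tilting the family towards
    z moves it into Q t. *)
Lemma tent_selection N (ks : 'I_N -> variation) z :
  (forall i, admissible (ks i)) -> inner_admissible z ->
  exists (Q : 'I_T -> set 'cV[R]_m) (M : R),
    [/\ 0 < M, forall t, tent (U t) (u t) (Q t)
      & forall t i, Q t (u t + (M *: z + ks i).1.2 t)].
Proof.
move=> Kks [zx zu z0].
have /choice[Q QP] : forall t, exists Q : set 'cV[R]_m,
    [/\ Q `<=` qu t, tent (U t) (u t) Q, relint Q (u t + z.1.2 t)
      & aff Q = aff (qu t)].
  by move=> t; have [_ _] := qu_local_tent t; apply.
have /choice[Mti MtiP] : forall p : 'I_T * 'I_N, exists M : R, 0 < M /\
    forall M', M <= M' ->
      Q p.1 (u p.1 + (M' *: z.1.2 p.1 + (ks p.2).1.2 p.1)).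
  move=> [t i]; have [_ [_ cQ _] Qz affE] := QP t.
  have [_ kt _] := Kks i.
  have [M M0 MP] := relint_absorbs cQ affE (cone_vertex (qu_cone t)) Qz (kt t).
  by exists M.
exists Q, (1 + \sum_p Mti p); split=> [|t|t i].
- by rewrite ltr_pwDl// sumr_ge0// => p _; have [/ltW] := MtiP p.
- by have [] := QP t.
have [_] := MtiP (t, i); apply; rewrite (bigD1 (t, i))//= addrCA lerDl.
by rewrite addr_ge0// sumr_ge0// => p _; have [/ltW] := MtiP p.
Qed.

(** The tent maps turn a small nonnegative combination of admissible variations
    into states in S and controls in U. As z is killed by the linearized
    constraints, tilting ks towards z preserves spanning, so local surjectivity
    produces a feasible trajectory whose cost is smaller than the optimal one. *)
Lemma spanning_contradicts_optimality N (ks : 'I_N -> variation) z :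
  (forall i, inner_admissible (ks i)) ->
  (forall y : constraint -> R, (exists j, y j != 0) ->
     exists i, enorm y <= \sum_j y j * linearized j (ks i)) ->
  inner_admissible z -> (forall j, linearized j z = 0) -> False.
Proof.
move=> Kks span Kz Az.
have [Q [M [M0 Qtent Qk]]] :=
  tent_selection (fun i => inner_admissible_sub (Kks i)) Kz.
pose k i := M *: z + ks i.
have kx i t : qx t (x t + (k i).1.1 t).
  have [zx _ _] := Kz; have [kx _ _] := Kks i.
  exact: (cone_dirD (qx_cone t) (cone_dirZ (qx_cone t) (ltW M0) (zx t)) (kx t)).
have k0 i : 0 <= (k i).2.
  have [_ _ z0] := Kz; have [_ _ k0] := Kks i.
  by rewrite addr_ge0// mulr_ge0// ltW.
have Ak j i : linearized j (k i) = linearized j (ks i).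
  by rewrite linearized_linear Az scaler0 add0r.
have /choice[psix psixP] := fun t => tent_strict (qx_tent t).
have /choice[psiu psiuP] := fun t => tent_strict (Qtent t).
pose p (v : 'rV[R]_N) : variation := \sum_i v ord0 i *: k i.
have pE v : p v = ((fun t => \sum_i v ord0 i *: (k i).1.1 t,
    fun t => \sum_i v ord0 i *: (k i).1.2 t), \sum_i v ord0 i * (k i).2).
  exact: sum_variation.
have p_linear : linear p.
  move=> a v w; rewrite /p scaler_sumr -big_split; apply: eq_bigr => i _ /=.
  by rewrite !mxE scalerDl scalerA.
have p0 : p 0 = 0 by rewrite /p big1// => i _; rewrite mxE scale0r.
have pxL t : linear (fun v => (p v).1.1 t) by move=> a v w; rewrite p_linear.
have puL t : linear (fun v => (p v).1.2 t) by move=> a v w; rewrite p_linear.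
have prL : linear (fun v => (p v).2 : R^o) by move=> a v w; rewrite p_linear.
have bounded (n : nat) (L : 'rV[R]_N -> 'cV[R]_n) (LL : linear L) :=
  finite_coords_linear_bounded LL (finite_coords_mx R 1 N).
pose X t (v : 'rV[R]_N) := psix t (x t + (p v).1.1 t).
pose V t (v : 'rV[R]_N) := psiu t (u t + (p v).1.2 t).
have X0 t : X t 0 = x t by rewrite /X p0 addr0; have [] := psixP t.
have V0 t : V t 0 = u t by rewrite /V p0 addr0; have [] := psiuP t.
have sX t : strict_diff (X t) (fun v => (p v).1.1 t) 0.
  have aff := strict_diff_affine (x t) 0 (pxL t) (bounded _ _ (pxL t)).
  apply: (strict_diff_comp (g := psix t) (M := id) aff).
  by rewrite p0 addr0; have [] := psixP t.
have sV t : strict_diff (V t) (fun v => (p v).1.2 t) 0.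
  have aff := strict_diff_affine (u t) 0 (puL t) (bounded _ _ (puL t)).
  apply: (strict_diff_comp (g := psiu t) (M := id) aff).
  by rewrite p0 addr0; have [] := psiuP t.
have sXV t := strict_diff_pair (sX (at_time t)) (sV t).
pose g (j : constraint) (v : 'rV[R]_N) : R^o :=
  match j with
  | inl (inl (t, i)) =>
      (X (at_succ t) v - f t (X (at_time t) v, V t v)) i 0
  | inl (inr a) => (\sum_t F t *m V t v) a 0
  | inr _ => \sum_t c t (X (at_time t) v, V t v) + (p v).2
  end.
have sg j : strict_diff (g j) (fun v => linearized j (p v)) 0.
  case: j => [[[t i]|a]|[]] /=.
  - apply: (@strict_diff_coord R _ d 1 (fun v => X (at_succ t) v - f t (X (at_time t) v, V t v))
      (fun v => (p v).1.1 (at_succ t) - 'd (f t) (xu t) ((p v).1.1 (at_time t), (p v).1.2 t))).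
    apply: strict_diffB (sX _) _.
    apply: (strict_diff_comp (g := f t) (M := 'd (f t) (xu t)) (sXV t)).
    by rewrite X0 V0; exact: continuously_differentiable_strict.
  - apply: (@strict_diff_coord R _ (freq_dim R W) 1 (fun v => \sum_t F t *m V t v)
      (fun v => \sum_t F t *m (p v).1.2 t)).
    apply: strict_diff_sum => t.
    apply: (strict_diff_comp (g := mulmx (F t)) (M := mulmx (F t)) (sV t)).
    by apply: strict_diff_linear (finite_coords_mx R m 1) _ => l y z'; rewrite linearP.
  apply: (@strict_diffD R _ _ (fun v => \sum_t c t (X (at_time t) v, V t v))
     (fun v => (p v).2) (fun v => \sum_t 'd (c t) (xu t) ((p v).1.1 (at_time t), (p v).1.2 t))).
    apply: strict_diff_sum => t.
    apply: (strict_diff_comp (g := c t) (M := 'd (c t) (xu t)) (sXV t)).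
    by rewrite X0 V0; exact: continuously_differentiable_strict_scalar.
  exact: strict_diff_linear (finite_coords_mx R 1 N) prL.
have pd i : p (delta_mx 0 i) = k i.
  rewrite /p (bigD1 i)//= mxE !eqxx scale1r big1 ?addr0// => l li.
  by rewrite mxE eqxx (negPf li) scale0r.
have spang y : (exists j, y j != 0) ->
    exists i, enorm y <= \sum_j y j * linearized j (p (delta_mx 0 i)).
  by move=> /span[i yi]; exists i; under eq_bigr do rewrite pd Ak.
have /choice[rx rxP] : forall t, exists r : R, 0 < r /\
    forall v : 'rV[R]_N, `|v| < r ->
    (forall i, 0 <= v 0 i) -> S t (X t v).
  move=> t; have [_ _ [e e0 eP]] := psixP t.
  have [C C0 CP] := bounded _ _ (pxL t).
  exists (e / C); split; first exact: divr_gt0.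
  move=> v vr v0; apply: eP; first by rewrite pE; exact: cone_dir_sum.
  by rewrite (le_lt_trans (CP v))// mulrC -ltr_pdivlMr.
have /choice[ru ruP] : forall t, exists r : R, 0 < r /\
    forall v : 'rV[R]_N, `|v| < r ->
    (forall i, 0 <= v 0 i) -> U t (V t v).
  move=> t; have [_ _ [e e0 eP]] := psiuP t.
  have [C C0 CP] := bounded _ _ (puL t).
  exists (e / C); split; first exact: divr_gt0.
  have [_ cQ _] := Qtent t.
  move=> v vr v0; apply: eP; first by rewrite pE; exact: cone_dir_sum cQ v0 (Qk t).
  by rewrite (le_lt_trans (CP v))// mulrC -ltr_pdivlMr.
(* below rho all the tent maps land in the constraint sets *)
pose rho := Num.min (\big[Num.min/1]_t rx t) (\big[Num.min/1]_t ru t).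
have rho0 : 0 < rho.
  rewrite lt_min; apply/andP; split; apply/bigmin_gtP; split=> // t _.
    by case: (rxP t).
  by case: (ruP t).
have [delta delta0 sol] := local_surjectivity sg spang rho0.
(* the target keeps the equality constraints and lowers the cost by delta / 2 *)
pose b (j : constraint) : R := if j is inr _ then - (delta / 2) else 0.
have [|v [v0 vrho gv]] := sol b.
  have -> : enorm b = delta / 2.
    rewrite /enorm (bigD1 (inr tt))//= big1 ?addr0.
      by rewrite sqrtr_sqr normrN gtr0_norm ?divr_gt0.
    by move=> [[?|?]|[]]//= _; rewrite expr0n.
  by lra.
move: vrho; rewrite lt_min => /andP[/bigmin_gtP[_ vx] /bigmin_gtP[_ vu]].
have [[xf _ _ uF] opt] := xu_optimal.
have feas : feasible f S U W (fun t => X t v) (fun t => V t v).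
  split=> [t|t|t|].
  - apply/matrixP => i j; rewrite ord1.
    have := gv (inl (inl (t, i))); rewrite /= !X0 V0 -xf subrr !mxE addr0.
    by move/eqP; rewrite subr_eq0 => /eqP.
  - by have [_] := rxP t; apply=> //; exact: vx.
  - by have [_] := ruP t; apply=> //; exact: vu.
  have F0 : \sum_t F t *m V t 0 = 0.
    by rewrite -[RHS]uF; apply: eq_bigr => t _; rewrite V0.
  apply/matrixP => a j; rewrite ord1; have := gv (inl (inr a)).
  by rewrite /= F0 addr0.
have cost0 : \sum_t c t (X (at_time t) 0, V t 0) = total_cost c x u.
  by apply: eq_bigr => t _; rewrite X0 V0.
have := opt _ _ feas; have := gv (inr tt); rewrite /= cost0 p0 addr0.
rewrite [total_cost c (fun t => X t v) _]/total_cost.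
have : 0 <= (p v).2.
  by rewrite pE /= sumr_ge0// => i _; exact: mulr_ge0 (v0 i) (k0 i).
by lra.
Qed.

Section Multipliers.
Variables (etaf : 'I_T -> 'cV[R]_d) (etaC : R) (etau : 'cV[R]_(freq_dim R W)).

Let H := hamiltonian f c W etaC etau.

Definition state_grad t := grad (fun z => H (etaf t) t z (u t)) (x (at_time t)).
Definition control_grad t := grad (fun z => H (etaf t) t (x (at_time t)) z) (u t).

(** The pairing of the multipliers with the linearized constraints, rearranged by
    variables instead of constraints (see separator_lagrangian). *)
Definition lagrangian (p : variation) : R :=
  \sum_t (dot (state_grad t) (p.1.1 (at_time t)) - dot (etaf t) (p.1.1 (at_succ t)))
  + \sum_t dot (control_grad t) (p.1.2 t) - etaC * p.2.

Lemma lagrangian_linear : linear (lagrangian : _ -> R^o).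
Proof.
move=> k p q; rewrite /lagrangian.
have dL n (w : 'cV[R]_n) y z : dot w (k *: y + z) = k * dot w y + dot w z.
  exact: dot_linear.
rewrite (eq_bigr (fun t =>
  k * (dot (state_grad t) (p.1.1 (at_time t)) - dot (etaf t) (p.1.1 (at_succ t)))
  + (dot (state_grad t) (q.1.1 (at_time t)) - dot (etaf t) (q.1.1 (at_succ t)))));
  last by move=> t _; rewrite !dL; ring.
rewrite [X in _ + X - _](eq_bigr (fun t => k * dot (control_grad t) (p.1.2 t)
  + dot (control_grad t) (q.1.2 t))); last by move=> t _; rewrite dL.
by rewrite !big_split/= -!mulr_sumr !big_split/= /GRing.scale/=; ring.
Qed.

(** The total coefficient, in the Lagrangian, of the state variation at time s.
    Each of the two sums has at most one term; the first is empty at the final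
    time and the second at the initial time, which gives the transversality
    conditions. *)
Definition adjoint_defect (s : 'I_T.+1) : 'cV[R]_d :=
  \sum_(t | at_time t == s) state_grad t - \sum_(t | at_succ t == s) etaf t.

Definition state_variation (s : 'I_T.+1) (w : 'cV[R]_d) : variation :=
  ((fun t => if t == s then w else 0, fun=> 0), 0).

Definition control_variation (s : 'I_T) (w : 'cV[R]_m) : variation :=
  ((fun=> 0, fun t => if t == s then w else 0), 0).

Lemma dot0r n (w : 'cV[R]_n) : dot w 0 = 0.
Proof. by rewrite /dot big1// => i _; rewrite mxE mulr0. Qed.

Lemma dot_suml n (I : Type) (s : seq I) (P : pred I) (w : I -> 'cV[R]_n) v :
  dot (\sum_(i <- s | P i) w i) v = \sum_(i <- s | P i) dot (w i) v.
Proof.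
elim/big_rec2 : _ => [|i a b _ <-]; first by rewrite dotC dot0r.
by rewrite dotC -[X in dot v (X + _)]scale1r dot_linear scale1r !(dotC v).
Qed.

Lemma lagrangian_state s w :
  lagrangian (state_variation s w) = dot (adjoint_defect s) w.
Proof.
rewrite /lagrangian /= mulr0 subr0 [X in _ + X]big1 ?addr0; last first.
  by move=> t _; rewrite dot0r.
have -> : dot (adjoint_defect s) w =
    \sum_(t | at_time t == s) dot (state_grad t) w
    - \sum_(t | at_succ t == s) dot (etaf t) w.
  rewrite -!dot_suml ![dot _ w]dotC /adjoint_defect.
  exact: (linear_morphB (dot_linear w)).
rewrite sumrB; congr (_ - _); rewrite [RHS]big_mkcond; apply: eq_bigr => t _;
  by case: ifP => // _; rewrite dot0r.
Qed.

Lemma lagrangian_control s w :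
  lagrangian (control_variation s w) = dot (control_grad s) w.
Proof.
rewrite /lagrangian /= mulr0 subr0 big1 ?add0r; last first.
  by move=> t _; rewrite !dot0r subrr.
rewrite (bigD1 s)//= eqxx big1 ?addr0// => t /negPf->.
by rewrite dot0r.
Qed.

Lemma adjoint_defect_inner (t s : 'I_T) : t = s.+1 :> nat ->
  adjoint_defect (at_time t) = state_grad t - etaf s.
Proof.
move=> ts; rewrite /adjoint_defect (big_pred1 t); last first.
  by move=> k /=; rewrite -!val_eqE.
congr (_ - _); rewrite (big_pred1 s)// => k.
by rewrite /= -!val_eqE /= /bump /= add1n ts eqSS.
Qed.

Lemma adjoint_defect_initial (T_gt0 : (0 < T)%N) :
  adjoint_defect ord0 = state_grad (Ordinal T_gt0).
Proof.
rewrite /adjoint_defect (big_pred1 (Ordinal T_gt0)); last first.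
  by move=> k /=; rewrite -!val_eqE.
by rewrite big_pred0 ?subr0.
Qed.

Lemma adjoint_defect_final (t : 'I_T) : t.+1 = T ->
  adjoint_defect ord_max = - etaf t.
Proof.
move=> tT; rewrite /adjoint_defect big_pred0; last first.
  by move=> k; rewrite -val_eqE /= ltn_eqF.
rewrite sub0r (big_pred1 t)// => k.
by rewrite /= -!val_eqE /= /bump /= add1n -[X in _ == X]tT eqSS.
Qed.

(** Admissible variations are limits of inner ones: add e times a variation whose
    controls are in the relative interiors, and let e tend to 0. *)
Lemma lagrangian_admissible :
  (forall p, inner_admissible p -> lagrangian p <= 0) ->
  forall p, admissible p -> lagrangian p <= 0.
Proof.
move=> inner p Kp.
have /choice[w wP] := fun t => relint_neq0 (qu_cone t).
pose q : variation := ((fun=> 0, w), 0).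
have Kq : inner_admissible q.
  split=> [t|t|]; [|exact: wP|exact: lexx].
  by rewrite /= addr0; exact: cone_vertex (qx_cone t).
have small (e : R) : 0 < e -> e * lagrangian q + lagrangian p <= 0.
  move=> e0; rewrite -[leLHS]/(e *: (lagrangian q : R^o) + lagrangian p).
  rewrite -lagrangian_linear; apply: inner.
  exact: inner_admissibleD (inner_admissibleZ e0 Kq) Kp.
rewrite leNgt; apply/negP => p0.
have := small (lagrangian p / (2 * (1 + `|lagrangian q|))).
have l1 : 0 < 1 + `|lagrangian q| by rewrite ltr_pwDl.
move=> /(_ (divr_gt0 p0 (mulr_gt0 (ltr0n R 2) l1))).
set e := _ / _ => le0; have e0 : 0 < e by rewrite divr_gt0// mulr_gt0.
have el : e * (1 + `|lagrangian q|) = lagrangian p / 2.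
  by rewrite /e; field; rewrite lt0r_neq0.
have : - (e * `|lagrangian q|) <= e * lagrangian q.
  by rewrite -mulrN ler_pM2l//; have := ler_norm (- lagrangian q); rewrite normrN; lra.
lra.
Qed.

End Multipliers.

Section MultipliersOfSeparator.
Variable y : constraint -> R.

(** The sign is that of the Hamiltonian, where the dynamics enter positively and
    the cost and frequency terms negatively. *)
Definition dyn_multiplier (t : 'I_T) : 'cV[R]_d := - \col_i y (inl (inl (t, i))).
Definition freq_multiplier : 'cV[R]_(freq_dim R W) := - \col_a y (inl (inr a)).
Definition cost_multiplier : R := - y (inr tt).

(** Summation over constraints is exchanged with summation over time, and the
    differentials of f and c are split into their state and control parts, which
    are those of the Hamiltonian. *)
Lemma separator_lagrangian p : \sum_j y j * linearized j p =
  lagrangian dyn_multiplier cost_multiplier freq_multiplier p.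
Proof.
have dotN n (w v : 'cV[R]_n) : dot (- w) v = - dot w v.
  by rewrite /dot -sumrN; apply: eq_bigr => i _; rewrite mxE mulNr.
have dotB n (w v v' : 'cV[R]_n) : dot w (v - v') = dot w v - dot w v'.
  exact: (linear_morphB (dot_linear w)).
have dotD n (w v v' : 'cV[R]_n) : dot w (v + v') = dot w v + dot w v'.
  by have := dot_linear w 1 v v'; rewrite !scale1r.
have Dsplit (V : normedModType R) (h : 'cV[R]_d * 'cV[R]_m -> V) z v w :
    'd h z (v, w) = 'd h z (v, 0) + 'd h z (0, w).
  by rewrite -linearD; congr ('d h z _); congr (_, _); rewrite /= ?addr0 ?add0r.
rewrite !big_sumType/= /lagrangian.
have -> : \sum_(ti : 'I_T * 'I_d) y (inl (inl ti)) * linearized (inl (inl ti)) p =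
    \sum_t - dot (dyn_multiplier t)
      (p.1.1 (at_succ t) - 'd (f t) (xu t) (p.1.1 (at_time t), p.1.2 t)).
  transitivity (\sum_t \sum_i y (inl (inl (t, i))) *
    linearized (inl (inl (t, i))) p).
    by rewrite pair_bigA; apply: eq_bigr => -[].
  apply: eq_bigr => t _; rewrite dotN opprK; apply: eq_bigr => i _.
  by rewrite [X in _ = X * _]mxE.
have -> : \sum_a y (inl (inr a)) * (\sum_t F t *m p.1.2 t) a 0 =
    \sum_t - dot freq_multiplier (F t *m p.1.2 t).
  have -> : \sum_a y (inl (inr a)) * (\sum_t F t *m p.1.2 t) a 0 =
      - dot freq_multiplier (\sum_t F t *m p.1.2 t).
    by rewrite dotN opprK; apply: eq_bigr => a _; rewrite [X in _ = X * _]mxE.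
  by rewrite [dot _ (\sum_t _)]dotC dot_suml sumrN; congr (- _);
    apply: eq_bigr => t _; rewrite dotC.
rewrite (big_pred1 tt) => [|[]//]; rewrite mulrDr mulr_sumr.
rewrite addrA /cost_multiplier mulNr opprK; congr (_ + _).
rewrite -!big_split/=; apply: eq_bigr => t _.
rewrite /state_grad /control_grad dot_grad_state// dot_grad_control//.
by rewrite (Dsplit _ (f t)) (Dsplit _ (c t)) dotB dotD; ring.
Qed.

Lemma separator_nontrivial : (exists j, y j != 0) ->
  ~ ((forall t, dyn_multiplier t = 0) /\ cost_multiplier = 0 /\
     freq_multiplier = 0).
Proof.
move=> [j /eqP yj] [f0 [c0 g0]]; apply: yj; case: j => [[[t i]|a]|[]].
- move/(congr1 (fun w : 'cV[R]_d => w i 0)): (f0 t).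
  by rewrite !mxE => /eqP; rewrite oppr_eq0 => /eqP.
- move/(congr1 (fun w : 'cV[R]_(freq_dim R W) => w a 0)): g0.
  by rewrite !mxE => /eqP; rewrite oppr_eq0 => /eqP.
- by move/eqP: c0; rewrite oppr_eq0 => /eqP.
Qed.

End MultipliersOfSeparator.

(** If no hyperplane separated 0 from the images of the inner variations, these
    images would span positively, against optimality. *)
Lemma separator_exists : exists2 y : constraint -> R, exists j, y j != 0 &
  forall p, inner_admissible p -> \sum_j y j * linearized j p <= 0.
Proof.
apply: contrapT => nosep.
have [|||y y0|N [ks [Kks span [z Kz Az]]]] := positive_spanning_with_zero
    (P := variation) (K := inner_admissible) (A := linearized) (inr tt).
- exact: linearized_linear.
- by move=> p q Kp /inner_admissible_sub; exact: inner_admissibleD.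
- by move=> a p; exact: inner_admissibleZ.
- apply: contrapT => noy; apply: nosep; exists y => // p Kp.
  by rewrite leNgt; apply/negP => yp; apply: noy; exists p.
exact: spanning_contradicts_optimality Kks span Kz Az.
Qed.

End MaximumPrinciple.

Theorem mainTheorem1 (R : realType) (T d m : nat)
  (T_gt0 : (0 < T)%N) (d_gt0 : (0 < d)%N) (m_gt0 : (0 < m)%N)
  (f : 'I_T -> 'cV[R]_d * 'cV[R]_m -> 'cV[R]_d)
  (c : 'I_T -> 'cV[R]_d * 'cV[R]_m -> R^o)
  (f_C1 : forall t : 'I_T, continuously_differentiable (f t))
  (c_C1 : forall t : 'I_T, continuously_differentiable (c t))
  (S : 'I_T.+1 -> set 'cV[R]_d) (U : 'I_T -> set 'cV[R]_m)
  (S_neq0 : forall t : 'I_T.+1, S t !=set0)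
  (U_neq0 : forall t : 'I_T, U t !=set0)
  (W : 'I_m -> {set 'I_T})
  (x : 'I_T.+1 -> 'cV[R]_d) (u : 'I_T -> 'cV[R]_m)
  (xu_optimal : optimal f c S U W x u)
  (qx : 'I_T.+1 -> set 'cV[R]_d) (qu : 'I_T -> set 'cV[R]_m)
  (qx_tent : forall t : 'I_T.+1, tent (S t) (x t) (qx t))
  (qu_local_tent : forall t : 'I_T, local_tent (U t) (u t) (qu t)) :
  let H := hamiltonian f c W in
  exists (etaf : 'I_T -> 'cV[R]_d) (etax : 'I_T.+1 -> 'cV[R]_d)
         (etaC : R) (etau : 'cV[R]_(freq_dim R W)),
    (* (i) *)
    0 <= etaC /\
    (* (ii) *)
    ~ ((forall t : 'I_T, etaf t = 0) /\ etaC = 0 /\ etau = 0) /\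
    (* (iii) *)
    (forall t : 'I_T,
       x (at_succ t) =
       grad (fun zeta => H etaC etau zeta t (x (at_time t)) (u t)) (etaf t)) /\
    (forall s t : 'I_T, t = s.+1 :> nat ->
       etaf s =
       grad (fun xi => H etaC etau (etaf t) t xi (u t)) (x (at_time t))
       - etax (at_time t) /\
       dual_cone (x (at_time t)) (qx (at_time t)) (etax (at_time t))) /\
    (* (iv) *)
    (let t0 : 'I_T := Ordinal T_gt0 in
     grad (fun xi => H etaC etau (etaf t0) t0 xi (u t0)) (x ord0)
     - etax ord0 = 0) /\
    dual_cone (x ord0) (qx ord0) (etax ord0) /\
    (forall t : 'I_T, t.+1 = T -> etaf t = - etax ord_max) /\
    dual_cone (x ord_max) (qx ord_max) (etax ord_max) /\
    (* (v) *)
    (forall (t : 'I_T) (v : 'cV[R]_m), qu t (u t + v) ->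
       dot (grad (fun mu => H etaC etau (etaf t) t (x (at_time t)) mu) (u t)) v
       <= 0) /\
    (* (vi) *)
    freq_map W u = 0.
Proof.
move=> H.
have [y y0 sep] := separator_exists f_C1 c_C1 xu_optimal qx_tent qu_local_tent.
have lag p : admissible x u qx qu p -> lagrangian f c x u (dyn_multiplier y)
    (cost_multiplier y) (freq_multiplier y) p <= 0.
  apply: (lagrangian_admissible qx_tent qu_local_tent) => q Kq.
  by rewrite -separator_lagrangian//; exact: sep.
have vertex_x t : qx t (x t) by have [_ /cone_vertex] := qx_tent t.
have vertex_u t : qu t (u t) by have [_ /cone_vertex] := qu_local_tent t.
pose etaf := dyn_multiplier y; pose etau := freq_multiplier y.
pose etaC := cost_multiplier y.
pose etax := adjoint_defect f c x u etaf etaC etau.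
have etax_dual t : dual_cone (x t) (qx t) (etax t).
  move=> z qz; rewrite /etax -lagrangian_state; apply: lag; split=> [s|s|//] /=.
  - by case: eqP => [->|_]; rewrite ?addr0// addrC subrK.
  - by rewrite addr0.
exists etaf, etax, etaC, etau; split.
  have := lag (0, 1); rewrite /lagrangian /= mulr1.
  rewrite big1 => [|t _]; last by rewrite !dot0r subrr.
  rewrite big1 => [|t _]; last by rewrite dot0r.
  rewrite !add0r oppr_le0; apply; split=> [t|t|] /=.
  - by rewrite addr0.
  - by rewrite addr0.
  - exact: ler01.
split; first exact: separator_nontrivial.
have [[xf _ _ uF] _] := xu_optimal.
split; first by move=> t; rewrite grad_adjoint.
split.
  move=> s t ts; split; last exact: etax_dual.
  by rewrite /etax (adjoint_defect_inner _ _ _ _ _ _ _ ts) opprB addrC subrK.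
split.
  have t0E : at_time (Ordinal T_gt0) = ord0 by exact: val_inj.
  rewrite /etax (adjoint_defect_initial _ _ _ _ _ _ _ T_gt0) /state_grad t0E.
  exact: subrr.
split; first exact: etax_dual.
split; first by move=> t tT; rewrite /etax (adjoint_defect_final _ _ _ _ _ _ _ tT) opprK.
split; first exact: etax_dual.
split=> // t v quv.
rewrite -lagrangian_control; apply: lag; split=> [s|s|//] /=.
- by rewrite addr0.
- by case: eqP => [->|_]; rewrite ?addr0.
Qed.
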